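(* Let $\mathcal{A}_{jk}=\mathcal{A}_{kj}$ ($1\le j,k\le n$) be real constant $(m\times m)$-matrices such that the operator $$\mathfrak{A}_0(D_x)\boldsymbol u=\sum_{j,k=1}^n\mathcal{A}_{jk}\frac{\partial^2\boldsymbol u}{\partial x_j\partial x_k},\qquad\boldsymbol u=(u_1,\dots,u_m),$$ is strongly elliptic. Let $\mathfrak{S}\subset\mathbb{R}^m$ be a convex body for which there exists a set of unit outward normals $\{\boldsymbol\nu_1,\dots,\boldsymbol\nu_m,\boldsymbol\nu_{m+1}\}\subset\mathfrak{N}_{\mathfrak{S}}$ such that arbitrary $m$ vectors of this collection are linearly independent. The body $\mathfrak{S}$ is invariant for the system $\mathfrak{A}_0(D_x)\boldsymbol u=\boldsymbol 0$ in the half-space $\mathbb{R}^n_+$ if and only if $$\mathfrak{A}_0(D_x)=A\,L(D_x),$$ where $$L(D_x)=\sum_{j,k=1}^n a_{jk}\frac{\partial^2}{\partial x_j\partial x_k}$$ is a scalar elliptic operator (with real constant coefficients) and $A$ is a non-degenerate real $(m\times m)$-matrix (not necessarily symmetric) such that the operator $A\,L(D_x)$ is strongly elliptic.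
   Context: $\mathbb{R}^n_+=\{x=(x_1,\dots,x_n)\in\mathbb{R}^n:x_n>0\}$. Strong ellipticity of $\sum_{j,k}\mathcal{A}_{jk}\partial^2/\partial x_j\partial x_k$ means that there is $\delta>0$ with $\bigl(\sum_{j,k=1}^n\mathcal{A}_{jk}\sigma_j\sigma_k\boldsymbol\zeta,\boldsymbol\zeta\bigr)\ge\delta|\boldsymbol\sigma|^2|\boldsymbol\zeta|^2$ for all $\boldsymbol\sigma\in\mathbb{R}^n$, $\boldsymbol\zeta\in\mathbb{R}^m$, where $|\cdot|$ and $(\cdot,\cdot)$ are the Euclidean length and inner product. Convex body: a convex body $\mathfrak{S}$ in $\mathbb{R}^m$ is the closure of a convex proper subdomain (nonempty open convex set, not all of $\mathbb{R}^m$); it may be unbounded. $\partial^*\mathfrak{S}$ is the set of points $a\in\partial\mathfrak{S}$ at which the unit outward normal $\boldsymbol\nu(a)$ to $\partial\mathfrak{S}$ exists, and $\mathfrak{N}_{\mathfrak{S}}=\{\boldsymbol\nu(a):a\in\partial^*\mathfrak{S}\}$. Invariance: a set $\mathcal{S}\subset\mathbb{R}^m$ is called invariant for a second-order elliptic system in a domain $\Omega$ if every bounded classical solution $\boldsymbol u=(u_1,\dots,u_m)$ of the system which is continuous in $\overline\Omega$ (that is, $\boldsymbol u\in C^2(\Omega;\mathbb{R}^m)\cap C_b(\overline\Omega;\mathbb{R}^m)$) and satisfies $\boldsymbol u(x)\in\mathcal{S}$ for all $x\in\partial\Omega$ takes values in $\mathcal{S}$ everywhere in $\Omega$. *)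

(* Defs.v *)
From HB Require Import structures.
From mathcomp Require Import all_boot all_order all_algebra.
From mathcomp Require Import all_classical all_reals all_analysis.
Set Implicit Arguments.
Unset Strict Implicit.
Unset Printing Implicit Defensive.
Import Order.TTheory GRing.Theory Num.Theory.
Import numFieldNormedType.Exports.
Local Open Scope classical_set_scope.
Local Open Scope ring_scope.

(* The library norm on matrices is the maximum norm: it serves only for the
   topology, and the Euclidean length is defined separately. *)
Definition dotv (R : realType) (m : nat) (u v : 'cV[R]_m) : R :=
  \sum_(i < m) u i 0 * v i 0.

Definition elength (R : realType) (m : nat) (u : 'cV[R]_m) : R :=
  Num.sqrt (dotv u u).

Definition boundary (T : topologicalType) (A : set T) : set T :=
  closure A `\` A°.

Definition half_space (R : realType) (n : nat) : set 'cV[R]_n.+1 :=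
  [set x | 0 < x ord_max 0].
Arguments half_space : clear implicits.

Definition pd (R : realType) (n m : nat) (k : 'I_n)
    (u : 'cV[R]_n -> 'cV[R]_m) : 'cV[R]_n -> 'cV[R]_m :=
  fun x => 'D_(delta_mx k 0) u x.

(* Meant for open D. *)
Definition C2_on (R : realType) (n m : nat) (D : set 'cV[R]_n)
    (u : 'cV[R]_n -> 'cV[R]_m) : Prop :=
  [/\ forall x, D x -> {for x, continuous u},
      forall k x, D x ->
        derivable u x (delta_mx k 0) /\ {for x, continuous (pd k u)}
    & forall j k x, D x ->
        derivable (pd k u) x (delta_mx j 0) /\
        {for x, continuous (pd j (pd k u))}].

Definition system_op (R : realType) (n m : nat)
    (A : 'I_n -> 'I_n -> 'M[R]_m) (u : 'cV[R]_n -> 'cV[R]_m) :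
    'cV[R]_n -> 'cV[R]_m :=
  fun x => \sum_(j < n) \sum_(k < n) A j k *m pd j (pd k u) x.

(* A scalar operator acts on a vector-valued function componentwise. *)
Definition scalar_op (R : realType) (n m : nat)
    (a : 'I_n -> 'I_n -> R) (u : 'cV[R]_n -> 'cV[R]_m) :
    'cV[R]_n -> 'cV[R]_m :=
  fun x => \sum_(j < n) \sum_(k < n) a j k *: pd j (pd k u) x.

Definition strongly_elliptic (R : realType) (n m : nat)
    (A : 'I_n -> 'I_n -> 'M[R]_m) : Prop :=
  exists2 delta : R, 0 < delta &
    forall (sigma : 'cV[R]_n) (zeta : 'cV[R]_m),
      delta * elength sigma ^+ 2 * elength zeta ^+ 2 <=
      dotv ((\sum_(j < n) \sum_(k < n)
               (sigma j 0 * sigma k 0) *: A j k) *m zeta) zeta.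

Definition scalar_elliptic (R : realType) (n : nat)
    (a : 'I_n -> 'I_n -> R) : Prop :=
  forall sigma : 'cV[R]_n, sigma != 0 ->
    \sum_(j < n) \sum_(k < n) a j k * sigma j 0 * sigma k 0 != 0.

Definition convex_body (R : realType) (m : nat) (S : set 'cV[R]_m) : Prop :=
  exists D : set 'cV[R]_m,
    [/\ open D, D !=set0, convex_set D, D <> setT & S = closure D].

Definition supporting_normal (R : realType) (m : nat) (S : set 'cV[R]_m)
    (a nu : 'cV[R]_m) : Prop :=
  elength nu = 1 /\ forall x, S x -> dotv (x - a) nu <= 0.

(* Outward normals in the sense of convex analysis; the unit outward normal
   exists at the boundary points where there is one and only one of them, i.e.
   where the supporting hyperplane is unique. *)
Definition unit_outward_normal (R : realType) (m : nat) (S : set 'cV[R]_m)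
    (a nu : 'cV[R]_m) : Prop :=
  [/\ boundary S a, supporting_normal S a nu
    & forall mu, supporting_normal S a mu -> mu = nu].

Definition unit_normals (R : realType) (m : nat) (S : set 'cV[R]_m) :
    set 'cV[R]_m :=
  [set nu | exists a, unit_outward_normal S a nu].

(* Only the values of u on the closure of D matter; continuity there is for the
   subspace topology. *)
Definition invariant_set (R : realType) (n m : nat)
    (A : 'I_n -> 'I_n -> 'M[R]_m) (D : set 'cV[R]_n) (S : set 'cV[R]_m) :
    Prop :=
  forall u : 'cV[R]_n -> 'cV[R]_m,
    C2_on D u ->
    {within closure D, continuous u} ->
    [bounded u x | x in closure D] ->
    (forall x, D x -> system_op A u x = 0) ->
    (forall x, boundary D x -> S (u x)) ->
    forall x, D x -> S (u x).

(* Main.v *)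
Require Import Defs.
From HB Require Import structures.
From mathcomp Require Import all_boot all_order all_algebra.
From mathcomp Require Import all_classical all_reals all_analysis.
From mathcomp Require Import ring lra.
Set Implicit Arguments.
Unset Strict Implicit.
Unset Printing Implicit Defensive.
Import Order.TTheory GRing.Theory Num.Theory.
Import numFieldNormedType.Exports.
Local Open Scope classical_set_scope.
Local Open Scope ring_scope.
From mathcomp Require Import complex.

(** Sufficiency: for [A_jk = b_jk A] with [b] symmetric, a solution solves the
    scalar equation [sum b_jk d_j d_k u = 0] componentwise, and every
    [dotv (u - q) mu] with [mu] normal to the body at [q] satisfies the maximum
    principle for bounded functions in a half-space (barrier
    [|x|^2/r^2 + k (x_n/r - x_n^2/r^2)] on large half-balls of the maximum norm).

    Necessity: at a boundary point with a unique normal [nu] the body looks like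
    a half-space, so invariance of the body forces the following: a bounded
    solution with [(u, nu) = 0] on the boundary has [(u, nu) = 0] inside. No
    Poisson kernel is needed: this is tested only on solutions
    [Re (exp (i zeta.x) (w + i x_n v))], where [zeta = xi + tau e_n], [xi] is real
    and tangential and [Im tau > 0]. In terms of the companion matrix [K] of the
    pencil [tau |-> A(xi + tau e_n)] it says that, on sums of two generalized
    eigenvectors of order at most 2 with eigenvalues in one half-plane, the kernel
    of [(w, w') |-> (w, nu)] is [K]-invariant. Hence [K] is diagonalizable, the
    eigenvectors with [Im tau > 0] project isomorphically onto [C^m], and the
    [m+1] normals are eigenvectors of the operator that [K] induces on [C^m].
    Being in general position they all have the same eigenvalue [tau], so
    [A(xi + tau e_n) = 0]; taking real and imaginary parts, the coefficients of the
    pencil are real multiples of [A_nn], and polarization in [xi] concludes. *)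

(** * Linear algebra: matrix pencils *)

Lemma horner_mx_prod_undup (F : fieldType) (n : nat) (K : 'M[F]_n.+1)
    (s : seq F) (e : 'rV[F]_n.+1) :
  (forall a (v : 'rV_n.+1), v *m (K - a%:M) *m (K - a%:M) = 0 ->
     v *m (K - a%:M) = 0) ->
  e *m horner_mx K (\prod_(a <- s) ('X - a%:P)) = 0 ->
  e *m horner_mx K (\prod_(a <- undup s) ('X - a%:P)) = 0.
Proof.
move=> ss; have hX a : horner_mx K ('X - a%:P) = K - a%:M.
  by rewrite rmorphB /= horner_mx_X horner_mx_C.
elim: s e => [|a s IH] e /=; first by [].
rewrite big_cons rmorphM /= mulmxA hX => /IH.
case: ifP => [as_|]; last by rewrite big_cons rmorphM /= mulmxA hX.
rewrite (big_rem a) ?mem_undup //= mulrC !rmorphM /= hX.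
set Q := horner_mx K _; rewrite mulmxA => H.
have comQ : Q *m (K - a%:M) = (K - a%:M) *m Q.
  by rewrite -hX !mulmxE -!rmorphM mulrC.
rewrite -!mulmxE mulmxA; apply: ss; rewrite -mulmxA in H.
by rewrite -(mulmxA e) comQ mulmxA -mulmxA.
Qed.

(** Distinct linear factors are coprime, so the kernel of their product splits into eigenspaces. *)
Lemma kermxpoly_prod_sub (F : fieldType) (n : nat) (K : 'M[F]_n) (s : seq F) :
  uniq s -> (kermxpoly K (\prod_(a <- s) ('X - a%:P)%R)
             <= \sum_(a <- s) eigenspace K a)%MS.
Proof.
elim: s => [|a s IH] /=; first by rewrite !big_nil kermxpoly1 sub0mx.
move=> /andP[as_ us]; rewrite !big_cons kermxpolyM.
  by rewrite addsmxS ?IH // -eigenspace_poly.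
by rewrite coprimep_sym coprimep_XsubC root_prod_XsubC.
Qed.

(** By Cayley-Hamilton the product of the linear factors of the characteristic polynomial
    annihilates [K]; after removal of repetitions it still does, which makes [K] diagonalizable. *)
Lemma semisimple_sum_eigenspaces (F : closedFieldType) (n : nat)
    (K : 'M[F]_n.+1) :
  (forall a (v : 'rV_n.+1), v *m (K - a%:M) *m (K - a%:M) = 0 ->
     v *m (K - a%:M) = 0) ->
  exists2 s : seq F, uniq s & (1%:M <= \sum_(a <- s) eigenspace K a)%MS.
Proof.
move=> ss; have [s hs] := closed_field_poly_normal (char_poly K).
exists (undup s); first exact: undup_uniq.
rewrite (monicP (char_poly_monic K)) scale1r in hs.
apply: submx_trans (kermxpoly_prod_sub _ (undup_uniq s)).
apply/row_subP => i; apply/sub_kermxP; apply: horner_mx_prod_undup => //.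
by rewrite -hs Cayley_Hamilton mulmx0.
Qed.

(** * A common eigenvalue from vectors in general position *)

Section CommonEigenvalue.

Variables (F : closedFieldType) (m : nat) (X Y : 'M[F]_m.+1).
Variables (up : pred F) (nu : 'I_m.+2 -> 'cV[F]_m.+1).

(* [(v, w) K = (w, v X + w Y)], so [(v, a v)] is an eigenvector for [a] iff
   [a^2 v = v X + a v Y]. *)
Let K : 'M[F]_(m.+1 + m.+1) := block_mx 0 X 1%:M Y.

(** Encodes the independence of any [m.+1] of the [m.+2] vectors: a relation that misses one of them
    is trivial. *)
Hypothesis general_position : forall i0 (c : 'I_m.+2 -> F),
  c i0 = 0 -> \sum_i c i *: nu i = 0 -> forall i, c i = 0.

(** For [a = b] this yields the semisimplicity of [K], for [a != b] a dichotomy between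
    eigenvectors. Only [up a = up b] is asked for, so that both sides enter the dimension count. *)
Hypothesis key : forall a b (e f : 'rV[F]_(m.+1 + m.+1)) i, up a = up b ->
  e *m (K - a%:M) *m (K - a%:M) = 0 -> f *m (K - b%:M) *m (K - b%:M) = 0 ->
  lsubmx (e + f) *m nu i = 0 -> rsubmx (e + f) *m nu i = 0.

Let lsubK (e : 'rV[F]_(m.+1 + m.+1)) : lsubmx (e *m K) = rsubmx e.
Proof.
rewrite -[e in LHS]hsubmxK mul_row_block row_mxKl.
by rewrite mulmx0 add0r mulmx1.
Qed.

(** The vectors other than the first form a basis, so their matrix [N] is invertible. *)
Lemma common_eigenvalue_sep (v : 'rV[F]_m.+1) :
  (forall i, v *m nu i = 0) -> v = 0.
Proof.
move=> hv; pose N := \matrix_(j < m.+1) (nu (lift ord0 j))^T.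
have NU : N \in unitmx.
  rewrite -row_free_unit -kermx_eq0; apply/eqP/row_matrixP => i; rewrite row0.
  set k := row i _; have kN : k *m N = 0.
    by apply/sub_kermxP; rewrite row_sub.
  pose c j := if unlift ord0 j is Some j' then k 0 j' else 0.
  have c0 : forall j, c j = 0.
    apply: (@general_position ord0); first by rewrite /c unlift_none.
    rewrite big_ord_recl /c unlift_none scale0r add0r.
    apply: trmx_inj; rewrite trmx0 linear_sum -[RHS]kN mulmx_sum_row.
    by apply: eq_bigr => j _ /=; rewrite liftK linearZ /= rowK.
  by apply/rowP => j; have := c0 (lift ord0 j); rewrite /c liftK !mxE.
have : v *m N^T = 0.
  apply/rowP => j; have := hv (lift ord0 j).
  move=> /matrixP/(_ 0 0); rewrite !mxE => h.
  by rewrite -[RHS]h; apply: eq_bigr => l _; rewrite !mxE.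
by move/(congr1 (mulmx^~ (invmx N^T))); rewrite mul0mx mulmxK // unitmx_tr.
Qed.

(** If [f = e (K - a)] is nonzero, some [nu i] does not vanish on its left half. Subtracting a
    multiple of [f] from [e] puts the left half into the hyperplane of [nu i]; [key] puts the right
    half there too, and this forces [nu i] to vanish on the left half of [f]. *)
Lemma common_eigenvalue_semisimple a (e : 'rV[F]_(m.+1 + m.+1)) :
  e *m (K - a%:M) *m (K - a%:M) = 0 -> e *m (K - a%:M) = 0.
Proof.
set f := e *m _ => fK.
have eK : e *m K = a *: e + f by rewrite /f mulmxBr mul_mx_scalar addrC subrK.
have fK' : f *m K = a *: f.
  by move: fK; rewrite mulmxBr mul_mx_scalar => /eqP; rewrite subr_eq0 => /eqP.
have rf : rsubmx f = a *: lsubmx f by rewrite -lsubK fK' linearZ.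
suff l0 : lsubmx f = 0 by rewrite -[f]hsubmxK rf l0 scaler0 row_mx0.
apply: common_eigenvalue_sep => i; apply/eqP/negPn/negP => fi.
have f00 : (lsubmx f *m nu i) 0 0 != 0.
  by apply: contra fi => /eqP h; apply/eqP/matrixP => p q; rewrite !ord1 h mxE.
pose c := (lsubmx e *m nu i) 0 0 / (lsubmx f *m nu i) 0 0.
have h1 : lsubmx (e + - c *: f) *m nu i = 0.
  apply/matrixP => p q; rewrite !ord1 linearD linearZ /= mulmxDl -scalemxAl.
  rewrite mxE [in X in _ + X]mxE mulNr divfK // addrN mxE //.
have h2 : (- c *: f) *m (K - a%:M) *m (K - a%:M) = 0.
  by rewrite -!scalemxAl fK mul0mx scaler0.
have := key (erefl _) (fK : e *m _ *m _ = 0) h2 h1.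
rewrite -lsubK mulmxDl -scalemxAl eK fK' addrAC scalerA mulrC -scalerA -scalerDr.
rewrite linearD linearZ /= mulmxDl -scalemxAl h1 scaler0 add0r => h3.
by rewrite h3 eqxx in fi.
Qed.

Theorem common_eigenvalue :
  exists2 a, up a & forall v : 'rV[F]_m.+1,
    a ^+ 2 *: v = v *m X + a *: (v *m Y).
Proof.
have [s us full] := @semisimple_sum_eigenspaces F (m + m.+1)%N K
  common_eigenvalue_semisimple.
have eigK a (e : 'rV[F]_(m.+1 + m.+1)) : (e <= eigenspace K a)%MS ->
    e *m (K - a%:M) *m (K - a%:M) = 0.
  move=> /eigenspaceP h.
  by rewrite [e *m _]mulmxBr h mul_mx_scalar subrr mul0mx.
have eigr a (e : 'rV[F]_(m.+1 + m.+1)) : (e <= eigenspace K a)%MS ->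
    rsubmx e = a *: lsubmx e.
  by move=> /eigenspaceP h; rewrite -lsubK h linearZ.
have eig0 a (e : 'rV[F]_(m.+1 + m.+1)) : (e <= eigenspace K a)%MS ->
    (forall i, lsubmx e *m nu i = 0) -> e = 0.
  move=> ea /common_eigenvalue_sep l0.
  by rewrite -[e]hsubmxK (eigr _ _ ea) l0 scaler0 row_mx0.
(* For the combination of [e] and [f] whose left half is annihilated by [nu i], [key] gives
   [(a - b) G E = 0]. *)
have pair a b (e f : 'rV[F]_(m.+1 + m.+1)) i : up a = up b -> a != b ->
    (e <= eigenspace K a)%MS -> (f <= eigenspace K b)%MS ->
    lsubmx e *m nu i = 0 \/ lsubmx f *m nu i = 0.
  move=> uab ab ea fb; set E := lsubmx e *m _; set G := lsubmx f *m _.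
  have h0 : lsubmx (G 0 0 *: e + (- E 0 0) *: f) *m nu i = 0.
    rewrite linearD !linearZ /= mulmxDl -!scalemxAl -/E -/G.
    apply/matrixP => p q; rewrite !ord1 !mxE -!/(lsubmx _).
    by rewrite mulrC mulNr subrr.
  have ea' : (G 0 0 *: e <= eigenspace K a)%MS by exact: scalemx_sub.
  have fb' : ((- E 0 0) *: f <= eigenspace K b)%MS by exact: scalemx_sub.
  have := key uab (eigK _ _ ea') (eigK _ _ fb') h0.
  rewrite linearD /= (eigr _ _ ea') (eigr _ _ fb').
  rewrite !linearZ /= mulmxDl -!scalemxAl -/E -/G.
  move/matrixP/(_ 0 0); rewrite mxE [X in X + _]mxE [X in _ * X + _]mxE.
  rewrite [X in _ + X]mxE [X in _ + _ * X]mxE [RHS]mxE.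
  move=> h; have : (a - b) * (G 0 0 * E 0 0) = 0.
    by rewrite -[RHS]h; ring.
  move/eqP; rewrite !mulf_eq0 subr_eq0 (negbTE ab) /= => /orP[] /eqP H0.
    by right; apply/matrixP => p q; rewrite !ord1 H0 mxE.
  by left; apply/matrixP => p q; rewrite !ord1 H0 mxE.
pose t (j : 'I_(size s)) := nth 0 s j.
have t_inj : injective t.
  by move=> i j /eqP; rewrite /t nth_uniq // => /eqP/val_inj.
pose U b := (\sum_(j | up (t j) == b) eigenspace K (t j))%MS.
(* If [nu i] is nonzero on the left half of the [j]-th summand, [pair] makes it vanish on all the
   others, so the left halves cannot add up to zero. *)
have U_inj b (u : 'rV[F]_(m.+1 + m.+1)) : (u <= U b)%MS -> lsubmx u = 0 -> u = 0.
  move=> /sub_sumsmxP[w ->]; set e := fun j => w j *m eigenspace K (t j).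
  have et j : (e j <= eigenspace K (t j))%MS by exact: submxMl.
  rewrite -/(e _) linear_sum /= => sum0.
  apply: big1 => j /eqP uj; apply: eig0 (et j) _ => i.
  apply/eqP/negPn/negP => eji.
  have := congr1 (mulmx^~ (nu i)) sum0; rewrite mul0mx mulmx_suml (bigD1 j) ?uj //=.
  rewrite big1 ?addr0 => [h|k /andP[/eqP uk kj]]; first by rewrite h eqxx in eji.
  have tjk : t j != t k by rewrite (inj_eq t_inj) eq_sym.
  have ujk : up (t j) = up (t k) by rewrite uj uk.
  case: (pair _ _ _ _ i ujk tjk (et j) (et k)) => [h|//].
  by rewrite h eqxx in eji.
pose P : 'M[F]_(m.+1 + m.+1, m.+1) := col_mx 1%:M 0.
have lP k (u : 'M[F]_(k, m.+1 + m.+1)) : u *m P = lsubmx u.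
  by rewrite -[u in LHS]hsubmxK mul_row_col mulmx1 mulmx0 addr0.
have rankU b : \rank (U b *m P) = \rank (U b).
  rewrite -(mxrank_mul_ker (U b) P).
  suff -> : (U b :&: kermx P)%MS = 0 by rewrite mxrank0 addn0.
  apply/row_matrixP => i; rewrite row0; apply: (@U_inj b).
    by apply: submx_trans (row_sub _ _) (capmxSl _ _).
  by rewrite -lP; apply/sub_kermxP; apply: submx_trans (row_sub _ _) (capmxSr _ _).
have rank_le b : (\rank (U b) <= m.+1)%N by rewrite -rankU rank_leq_col.
(* [U true] and [U false] have rank at most [m.+1] and together fill a space of dimension
   [2 (m.+1)], so neither can be smaller. *)
have fullU : \rank (U true) = m.+1.
  apply/eqP; rewrite eqn_leq rank_le /=.
  have : (1%:M <= U true + U false)%MS.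
    apply: submx_trans full _; rewrite (big_nth 0) big_mkord.
    rewrite (bigID (fun j => up (t j))) /=.
    apply: addsmxS; rewrite /U.
      by rewrite (eq_bigl (fun j => up (t j) == true)) // => j; case: up.
    by rewrite (eq_bigl (fun j => up (t j) == false)) // => j; case: up.
  move/mxrankS; rewrite mxrank1 => h.
  have := leq_trans h (mxrank_adds_leqif _ _).1.
  move/leq_trans => /(_ (\rank (U true) + m.+1)%N).
  by rewrite leq_add2l leq_add2r; apply.
have lift_U (v : 'rV[F]_m.+1) : exists2 u : 'rV[F]_(m.+1 + m.+1),
    (u <= U true)%MS & lsubmx u = v.
  have : (v <= U true *m P)%MS.
    by apply: submx_full; rewrite /row_full rankU fullU.
  case/submxP => w ->; exists (w *m U true); first exact: submxMl.
  by rewrite -lP mulmxA.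
(* The left halves of [U true] fill the whole space, and [U true] is spanned by eigenvectors. *)
have span (z : 'cV[F]_m.+1) : (forall j (e : 'rV[F]_(m.+1 + m.+1)), up (t j) ->
    (e <= eigenspace K (t j))%MS -> lsubmx e *m z = 0) -> z = 0.
  move=> hz; rewrite -[z]mul1mx; apply/row_matrixP => i.
  rewrite row_mul row0; have [u /sub_sumsmxP[w ->] <-] := lift_U (row i 1%:M).
  rewrite linear_sum mulmx_suml big1 // => j /eqP uj.
  by apply: (hz j) => //; exact: submxMl.
have nu_neq0 i : nu i != 0.
  apply/eqP => nu0; pose c (j : 'I_m.+2) : F := (j == i)%:R.
  have ci0 : c (lift i ord0) = 0 by rewrite /c eq_sym (negbTE (neq_lift _ _)).
  have sum0 : \sum_j c j *: nu j = 0.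
    rewrite (bigD1 i) //= nu0 scaler0 add0r big1 // => j ji.
    by rewrite /c (negbTE ji) scale0r.
  by have /eqP := general_position ci0 sum0 i; rewrite /c eqxx oner_eq0.
(* If [nu i] is nonzero on an eigenvector for [t j], [pair] makes it vanish on those for all other
   eigenvalues on this side; by [span] such a [t j] exists. *)
have ex_tau i : exists a, forall j (e : 'rV[F]_(m.+1 + m.+1)), up (t j) ->
    (e <= eigenspace K (t j))%MS -> t j = a \/ lsubmx e *m nu i = 0.
  apply: contrapT => nex; move/eqP: (nu_neq0 i); apply; apply: span => j e uj ej.
  apply: contrapT => eji; apply: nex; exists (t j) => k f uk fk.
  have [->|tjk] := eqVneq (t j) (t k); first by left.
  have ujk : up (t j) = up (t k) by rewrite uj uk.
  by case: (pair _ _ _ _ i ujk tjk ej fk) => h; [case: eji|right].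
have [tau htau] := choice ex_tau.
(* [m.+2] vectors in dimension [m.+1] satisfy a nontrivial relation, and by general position none of
   its coefficients is zero. *)
have [k k0 ksum] : exists2 k : 'I_m.+2 -> F, forall i, k i != 0 &
    \sum_i k i *: nu i = 0.
  pose N : 'M[F]_(m.+2, m.+1) := \matrix_i (nu i)^T.
  have : kermx N != 0.
    by rewrite kermx_eq0 /row_free neq_ltn ltnS rank_leq_col.
  case/rowV0Pn => k /sub_kermxP kN kn0; exists (fun i => k 0 i); last first.
    apply: trmx_inj; rewrite trmx0 linear_sum -[RHS]kN mulmx_sum_row.
    by apply: eq_bigr => j _ /=; rewrite linearZ /= rowK.
  move=> i; apply: contra kn0 => /eqP ki; apply/eqP/rowP => j; rewrite mxE.
  apply: (general_position (i0 := i) (c := fun j => k 0 j)) => //.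
  apply: trmx_inj; rewrite trmx0 linear_sum -[RHS]kN mulmx_sum_row.
  by apply: eq_bigr => l _ /=; rewrite linearZ /= rowK.
(* Let [T] be the matrix that [K] induces on the left halves of [U true]; then
   [T nu_i = tau_i nu_i]. Applying [T - tau_0] to the relation gives one that misses [nu_0], hence a
   trivial one. *)
have tau_eq i : tau i = tau ord0.
  have sum0 : \sum_i (k i * (tau i - tau ord0)) *: nu i = 0.
    apply: span => j e uj ej; rewrite mulmx_sumr.
    have : (t j - tau ord0) *: (lsubmx e *m (\sum_i k i *: nu i)) = 0.
      by rewrite ksum mulmx0 scaler0.
    rewrite mulmx_sumr scaler_sumr => h; rewrite -[RHS]h; apply: eq_bigr => l _.
    rewrite -!scalemxAr scalerA; case: (htau l j e uj ej) => [->|->].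
      by rewrite mulrC.
    by rewrite !scaler0.
  have c0 : k ord0 * (tau ord0 - tau ord0) = 0 by rewrite subrr mulr0.
  have := general_position (c := fun i => k i * (tau i - tau ord0)) c0 sum0 i.
  by move/eqP; rewrite mulf_eq0 (negbTE (k0 i)) subr_eq0 => /eqP.
(* An eigenvector for another eigenvalue would be annihilated by every [nu i]. *)
have UE : (U true <= eigenspace K (tau ord0))%MS.
  apply/sumsmx_subP => j /eqP uj; apply/row_subP => l; set e := row l _.
  have ej : (e <= eigenspace K (t j))%MS by exact: row_sub.
  have [->|en0] := eqVneq e 0; first exact: sub0mx.
  have [<-|tj] := eqVneq (t j) (tau ord0); first exact: ej.
  case/eqP: en0; apply: eig0 (ej) _ => i.
  by case: (htau i j e uj ej) => // h; rewrite h tau_eq eqxx in tj.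
exists (tau ord0).
  (* Otherwise every summand of [U true] would be zero, against its rank. *)
  apply: contraT => ntau; have /eqP := fullU; rewrite /U big1 ?mxrank0 // => j /eqP uj.
  apply/row_matrixP => l; rewrite row0; set e := row l _.
  have ej : (e <= eigenspace K (t j))%MS by exact: row_sub.
  apply: eig0 (ej) _ => i; case: (htau i j e uj ej) => // h.
  by rewrite -(tau_eq i) -h uj in ntau.
move=> v; have [u uU uv] := lift_U v.
have uE := submx_trans uU UE; have uK := eigenspaceP uE.
have ur := eigr _ _ uE; rewrite uv in ur.
have : rsubmx (u *m K) = tau ord0 *: rsubmx u by rewrite uK linearZ.
rewrite -[in X in X -> _](hsubmxK u) mul_row_block row_mxKr uv ur row_mxKr.
by rewrite scalerA -expr2 => <-; rewrite -scalemxAl.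
Qed.

End CommonEigenvalue.

(** * Euclidean geometry of convex bodies *)

Lemma cvg_sum (K : numFieldType) (V : normedModType K) (T : Type)
    (F : set_system T) {FF : Filter F} (I : Type) (r : seq I)
    (f : I -> T -> V) (l : I -> V) :
  (forall i, f i x @[x --> F] --> l i) ->
  \sum_(i <- r) f i x @[x --> F] --> \sum_(i <- r) l i.
Proof. by move=> h; apply: cvg_big => // x; exact: add_continuous. Qed.

Section Dotv.
Variables (R : realType) (m : nat).
Implicit Types u v w : 'cV[R]_m.

Lemma dotvC u v : dotv u v = dotv v u.
Proof. by apply: eq_bigr => i _; rewrite mulrC. Qed.

Lemma dotvDl u v w : dotv (u + v) w = dotv u w + dotv v w.
Proof. by rewrite -big_split; apply: eq_bigr => i _; rewrite mxE mulrDl. Qed.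

Lemma dotvZl (k : R) u v : dotv (k *: u) v = k * dotv u v.
Proof. by rewrite mulr_sumr; apply: eq_bigr => i _; rewrite mxE mulrA. Qed.

Lemma dotvNl u v : dotv (- u) v = - dotv u v.
Proof. by rewrite -scaleN1r dotvZl mulN1r. Qed.

Lemma dotvBl u v w : dotv (u - v) w = dotv u w - dotv v w.
Proof. by rewrite dotvDl dotvNl. Qed.

Lemma dotv0l v : dotv 0 v = 0.
Proof. by rewrite -(scale0r 0) dotvZl mul0r. Qed.

Lemma dotvDr u v w : dotv w (u + v) = dotv w u + dotv w v.
Proof. by rewrite dotvC dotvDl !(dotvC w). Qed.

Lemma dotvZr (k : R) u v : dotv v (k *: u) = k * dotv v u.
Proof. by rewrite dotvC dotvZl dotvC. Qed.

Lemma dotvBr u v w : dotv w (u - v) = dotv w u - dotv w v.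
Proof. by rewrite dotvC dotvBl !(dotvC w). Qed.

Lemma dotv_ge0 u : 0 <= dotv u u.
Proof. by apply: sumr_ge0 => i _; rewrite -expr2 sqr_ge0. Qed.

Lemma sqr_coord_le_dotv u i : u i 0 ^+ 2 <= dotv u u.
Proof.
rewrite /dotv (bigD1 i) //= -expr2 lerDl.
by apply: sumr_ge0 => j _; rewrite -expr2 sqr_ge0.
Qed.

End Dotv.

Lemma coord_le_norm (R : realType) (m : nat) (u : 'cV[R]_m) i :
  `|u i 0| <= `|u|.
Proof. by rewrite [leRHS]/Num.norm /= mx_normrE (le_bigmax _ _ (i, 0)). Qed.

Lemma norm_le_coord (R : realType) (m : nat) (u : 'cV[R]_m) r :
  0 <= r -> (forall i, `|u i 0| <= r) -> `|u| <= r.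
Proof.
move=> r0 h; rewrite [leLHS]/Num.norm /= mx_normrE.
by apply/bigmax_leP; split => // -[i j] _; rewrite (ord1 j) h.
Qed.

Section DotvTopology.
Variables (R : realType) (m : nat).
Implicit Types u v w : 'cV[R]_m.

Lemma dotv_eq0 u : dotv u u = 0 -> u = 0.
Proof.
move=> u0; apply/colP => i; rewrite mxE; apply/eqP; rewrite -sqrf_eq0 eq_le sqr_ge0.
by rewrite andbT -u0 sqr_coord_le_dotv.
Qed.

Lemma dotv_le u v : `|dotv u v| <= m%:R * `|u| * `|v|.
Proof.
apply: le_trans (ler_norm_sum _ _ _) _.
rewrite -mulrA mulr_natl -[X in _ *+ X]card_ord -sumr_const.
by apply: ler_sum => i _; rewrite normrM ler_pM // coord_le_norm.
Qed.

Lemma dotv_continuous v : continuous (fun u => dotv u v).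
Proof.
move=> u; apply: (@cvg_sum _ _ _ (nbhs u)) => i; apply: cvgM; last exact: cvg_cst.
exact: coord_continuous.
Qed.

Lemma dotvv_continuous v : continuous (fun u => dotv (u - v) (u - v)).
Proof.
have c i : continuous (fun u => (u - v) i 0).
  have -> : (fun u => (u - v) i 0) = (fun u : 'cV[R]_m => u i 0 - v i 0).
    by apply/funext => w; rewrite !mxE.
  move=> u; apply: (@cvgB _ _ _ (nbhs u) _ (fun u : 'cV[R]_m => u i 0) (fun=> v i 0)).
    exact: coord_continuous.
  exact: cvg_cst.
by move=> u; apply: (@cvg_sum _ _ _ (nbhs u)) => i; apply: cvgM; exact: c.
Qed.

Lemma trmx_continuous p q : continuous (@trmx R p q).
Proof.
move=> A; apply/(@cvgrPdist_le _ _ _ (nbhs A)) => e e0.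
near=> B; rewrite [leLHS]/Num.norm /= mx_normrE; apply/bigmax_leP.
split; first exact: ltW.
move=> [i j] _; rewrite !mxE /=.
apply: le_trans (_ : `|A - B| <= e); last first.
  by near: B; apply: cvgr_dist_le => //; exact: cvg_id.
by rewrite [leRHS]/Num.norm /= mx_normrE; apply: le_trans (le_bigmax _ _ (j, i)); rewrite !mxE.
Unshelve. all: by end_near. Qed.

(** Heine-Borel, carried over from row vectors by transposition. *)
Lemma bounded_closed_compact_cV (A : set 'cV[R]_m) (r : R) :
  (forall u, A u -> `|u| <= r) -> closed A -> compact A.
Proof.
move=> Ar Ac.
have -> : A = (@trmx R 1 m) @` ((@trmx R 1 m) @^-1` A).
  apply/seteqP; split => [u Au|u [v /= Av <-] //].
  by exists (u^T); rewrite /= trmxK.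
apply: continuous_compact.
  by apply: continuous_subspaceT; exact: trmx_continuous.
apply: bounded_closed_compact; last first.
  by apply: closed_comp => // u _; exact: trmx_continuous.
exists r; split; first exact: num_real.
move=> x rx u /= /Ar ur; apply: le_trans (ltW rx); apply: le_trans ur.
rewrite [leLHS]/Num.norm /= mx_normrE; apply/bigmax_leP; split => // -[i j] _ /=.
by rewrite (ord1 i); have := coord_le_norm u^T j; rewrite !mxE.
Qed.

End DotvTopology.

Lemma closure_normP (R : realType) (m : nat) (D : set 'cV[R]_m) x :
  closure D x <-> forall e, 0 < e -> exists2 d, D d & `|x - d| < e.
Proof.
split=> [Dx e e0|h B /nbhs_ballP[e e0 eB]].
  have [d [Dd /= de]] := Dx _ (nbhsx_ballx x e e0).
  by exists d => //; move: de; rewrite -ball_normE.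
by have [d Dd de] := h _ e0; exists d; split => //; apply: eB; rewrite -ball_normE.
Qed.

(** * Convex bodies: nearest points and unique normals *)

Section ConvexBody.
Variables (R : realType) (m : nat) (S : set 'cV[R]_m).
Hypothesis S_body : convex_body S.

Lemma convex_body_closed : closed S.
Proof. by case: S_body => D [_ _ _ _ ->]; exact: closed_closure. Qed.

Lemma convex_body_neq0 : exists x, S x.
Proof.
by case: S_body => D [_ [x Dx] _ _ ->]; exists x; exact: subset_closure.
Qed.

Lemma convex_body_conv x y t : 0 <= t <= 1 -> S x -> S y -> S (x + t *: (y - x)).
Proof.
case: S_body => D [_ _ cD _ ->] t01 /closure_normP Sx /closure_normP Sy.
apply/closure_normP => e e0.
have [x' Dx' xx'] := Sx e e0; have [y' Dy' yy'] := Sy e e0.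
exists (x' + t *: (y' - x')).
  have /andP[t0 t1] := t01.
  have := cD y' x' (Itv01 t0 t1) (mem_set Dy') (mem_set Dx').
  rewrite inE; congr D; rewrite [LHS](_ : _ = t *: y' + (1 - t) *: x') //.
  by apply/colP => i; rewrite !mxE; ring.
have -> : x + t *: (y - x) - (x' + t *: (y' - x')) =
    (1 - t) *: (x - x') + t *: (y - y').
  by apply/colP => i; rewrite !mxE; ring.
apply: le_lt_trans (ler_normD _ _) _; rewrite !normrZ.
have /andP[t0 t1] := t01.
rewrite (ger0_norm t0) ger0_norm ?subr_ge0 //.
have [->|tn0] := eqVneq t 0; first by rewrite subr0 mul1r mul0r addr0.
have tp : 0 < t by rewrite lt_neqAle eq_sym tn0.
rewrite -[ltRHS](_ : (1 - t) * e + t * e = e); last by ring.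
by rewrite ler_ltD ?ler_wpM2l ?ltr_pM2l ?subr_ge0 // ltW.
Qed.

(** [q] is a point of [S] nearest to [p] in Euclidean distance; comparing it with the points of the
    segment from [q] to [s] gives the obtuse angle condition. *)
Lemma convex_body_projection p :
  exists2 q, S q & forall s, S s -> dotv (s - q) (p - q) <= 0.
Proof.
have [s0 Ss0] := convex_body_neq0.
(* A point of [S] no farther from [p] than [s0] has maximum norm at most [r], because
   [c <= c^2 + 1]; so the minimum can be sought on a compact set. *)
pose f x := dotv (x - p) (x - p); pose r := `|p| + (f s0 + 1).
pose B := S `&` [set x | `|x| <= r].
have r0 : 0 <= r by rewrite !addr_ge0 // dotv_ge0.
have far x : f x <= f s0 -> `|x| <= r.
  move=> fx; rewrite -[x](subrK p) addrC; apply: le_trans (ler_normD _ _) _.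
  rewrite lerD2l; apply: norm_le_coord; first by rewrite addr_ge0 // dotv_ge0.
  move=> i; have := le_trans (sqr_coord_le_dotv (x - p) i) fx.
  rewrite -real_normK ?num_real //; set c := `|_| => cf.
  have := dotv_ge0 (s0 - p); rewrite -/(f s0); nra.
have cB : compact B.
  apply: (@bounded_closed_compact_cV R m B r) => [u [] //|].
  apply: closedI; first exact: convex_body_closed.
  apply: (@preimage_closed _ _ (fun x : 'cV[R]_m => `|x|) [set y | y <= r]).
    by move=> x _; exact: norm_continuous.
  exact: closed_le.
have [] := @compact_EVT_min _ R f B _ cB.
- by exists s0; split => //; exact: far.
- by apply: continuous_subspaceT; exact: dotvv_continuous.
move=> q /set_mem[Sq _] qmin; exists q => // s Ss.
have fq x : S x -> f q <= f x.
  move=> Sx; have [xr|xr] := leP (`|x|) r; first by apply: qmin; apply: mem_set.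
  apply: le_trans (_ : f s0 <= _).
    by apply: qmin; apply: mem_set; split => //; exact: far.
  by rewrite leNgt; apply/negP => h; have := far x (ltW h); rewrite leNgt xr.
set d := dotv _ _; have dE t : 0 <= t <= 1 ->
    0 <= t * (t * dotv (s - q) (s - q) - 2 * d).
  move=> t01; have := fq _ (convex_body_conv t01 Sq Ss).
  have -> : d = - dotv (s - q) (q - p) by rewrite /d -(opprB q p) dotvC dotvNl dotvC.
  rewrite /f addrAC; move: (s - q) (q - p) => u v.
  rewrite !(dotvDl, dotvDr, dotvZl, dotvZr) (dotvC v u); lra.
rewrite leNgt; apply/negP => d0.
set c := dotv (s - q) (s - q) in dE; have c0 : 0 <= c by exact: dotv_ge0.
have cd : 0 < c + d by lra.
(* For this [t] one has [t * c <= d], so [t * c - 2 * d] is negative; the denominator [c + d] rather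
   than [c] keeps [t] at most 1. *)
have := dE (d / (c + d)).
rewrite divr_ge0 ?ler_pdivrMr ?mul1r ?lerDr //; last 2 first.
- exact: ltW.
- exact: ltW.
move=> /(_ c0); rewrite pmulr_rge0 ?divr_gt0 //.
have : d / (c + d) * c <= d by rewrite mulrAC ler_pdivrMr //; nra.
lra.
Qed.

Lemma unit_vector (w : 'cV[R]_m) : w != 0 -> exists2 k : R, 0 < k & elength (k *: w) = 1.
Proof.
move=> w0; have d0 : 0 < dotv w w.
  by rewrite lt_neqAle dotv_ge0 andbT eq_sym; apply: contra w0 => /eqP/dotv_eq0 ->.
exists (Num.sqrt (dotv w w))^-1; first by rewrite invr_gt0 sqrtr_gt0.
rewrite /elength dotvZl dotvZr -[X in _ * (_ * X)]sqr_sqrtr ?ltW //.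
by rewrite expr2 mulKf ?mulVf ?sqrtr1 // sqrtr_eq0 -ltNge.
Qed.

Lemma elength1 (w : 'cV[R]_m) : elength w = 1 <-> dotv w w = 1.
Proof.
split=> [h|h]; last by rewrite /elength h sqrtr1.
by rewrite -(sqr_sqrtr (dotv_ge0 w)) -/(elength w) h expr1n.
Qed.

Lemma unit_norm_le1 (w : 'cV[R]_m) : dotv w w = 1 -> `|w| <= 1.
Proof.
move=> w1; apply: norm_le_coord => // i.
by rewrite -(ler_pXn2r (n := 2)) ?nnegrE // expr1n real_normK ?num_real // -w1 sqr_coord_le_dotv.
Qed.

(* Near a boundary point with a unique supporting half-space the body looks like
   that half-space: otherwise normals at projections of points [a + t z] onto the
   body accumulate at a unit normal [mu] at [a] with [dotv z mu >= 0]. *)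
Lemma unique_normal_absorbs a nu (M e : R) :
  unit_outward_normal S a nu -> 0 < e ->
  exists2 t, 0 < t & forall z, `|z| <= M -> dotv z nu <= - e -> S (a + t *: z).
Proof.
move=> [[cSa _] _ nu_uniq] e0.
have Sa : S a by rewrite (closure_id S).1 //; exact: convex_body_closed.
apply: contrapT => nex.
have [z hz] : exists z : nat -> 'cV[R]_m, forall k,
    [/\ `|z k| <= M, dotv (z k) nu <= - e & ~ S (a + k.+1%:R^-1 *: z k)].
  suff : forall k : nat, exists zk : 'cV[R]_m, [/\ `|zk| <= M,
      dotv zk nu <= - e & ~ S (a + k.+1%:R^-1 *: zk)] by move=> h; have [g hg] := choice h; exists g.
  move=> k; apply: contrapT => nz; apply: nex.
  exists k.+1%:R^-1; first by rewrite invr_gt0.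
  by move=> z zM ze; apply: contrapT => nS; apply: nz; exists z.
pose C := m%:R * M.
have M0 : 0 <= M by have [h _ _] := hz 0%N; apply: le_trans h.
have C0 : 0 <= C by rewrite mulr_ge0.
(* [mu k] is the unit vector along [w], which points from the projection [q] to [a + t z]. The
   projection inequality at [a] gives [0 <= dotv (z k) (mu k)]; at the other points it says that
   [mu k] supports [S] at [a] up to the error [C / (k + 1)]. *)
have [mu hmu] : exists mu : nat -> 'cV[R]_m, forall k,
    [/\ dotv (mu k) (mu k) = 1, 0 <= dotv (z k) (mu k) &
      forall x, S x -> dotv (x - a) (mu k) <= k.+1%:R^-1 * C].
  suff : forall k : nat, exists muk : 'cV[R]_m, [/\ dotv muk muk = 1,
      0 <= dotv (z k) muk &
      forall x, S x -> dotv (x - a) muk <= k.+1%:R^-1 * C] by move=> h; have [g hg] := choice h; exists g.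
  move=> k; have [zM _ nS] := hz k.
  set t := k.+1%:R^-1 in nS *; have t0 : 0 < t by rewrite invr_gt0.
  have [q Sq hq] := convex_body_projection (a + t *: z k).
  set w := _ - q in hq.
  have w0 : w != 0.
    by rewrite /w subr_eq0; apply/eqP => wq; apply: nS; rewrite wq.
  have [l l0 hl] := unit_vector w0.
  have qE : q = a + t *: z k - w by rewrite /w opprB addrC subrK.
  have aq : a - q = w - t *: z k.
    by rewrite [in LHS]qE opprB opprD addrCA (addrA a) subrr add0r.
  clearbody w; have := hq a Sa; rewrite aq.
  rewrite dotvBl dotvZl subr_le0 => wz.
  have zw : 0 <= dotv (z k) w.
    by rewrite -(pmulr_rge0 _ t0); apply: le_trans wz; exact: dotv_ge0.
  exists (l *: w); split; first exact/elength1.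
    by rewrite dotvZr mulr_ge0 // ltW.
  move=> x Sx; apply: le_trans (_ : t * dotv (z k) (l *: w) <= _); last first.
    rewrite ler_wpM2l ?(ltW t0) //; apply: le_trans (ler_norm _) _.
    apply: le_trans (dotv_le _ _) _; rewrite -[leRHS]mulr1 ler_pM ?mulr_ge0 //.
      by rewrite ler_wpM2l.
    by apply: unit_norm_le1; exact/elength1.
  rewrite !dotvZr mulrCA ler_wpM2l ?(ltW l0) //.
  have xq : x - q = (x - a) - (t *: z k - w).
    by rewrite [in LHS]qE -addrA opprD addrA.
  have := hq x Sx; rewrite xq !dotvBl dotvZl; have := dotv_ge0 w; lra.
pose B := [set u : 'cV[R]_m | dotv u u = 1].
have cB : compact B.
  apply: (@bounded_closed_compact_cV R m B 1); first exact: unit_norm_le1.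
  have -> : B = (fun u : 'cV[R]_m => dotv (u - 0) (u - 0)) @^-1` [set 1].
    by apply/seteqP; split => u; rewrite /B /= subr0.
  apply: preimage_closed; last exact: closed_eq.
  by move=> u _; exact: dotvv_continuous.
(* A cluster point [v] of [mu] on the unit sphere supports [S] at [a] without error, hence equals
   [nu]. *)
have [|v [Bv clv]] := cB (mu @ \oo) _.
  by exists 0%N => // k _; have [] := hmu k.
have clN N (V : set 'cV[R]_m) : nbhs v V -> exists2 k, (N <= k)%N & V (mu k).
  move=> nV; have [] := clv [set u | exists2 k, (N <= k)%N & u = mu k] V _ nV.
    by exists N => // k /= Nk; exists k.
  by move=> _ [[k Nk ->] Vk]; exists k.
have vnu : v = nu.
  apply: nu_uniq; split; first exact/elength1.
  move=> x Sx; rewrite leNgt; apply/negP => d0.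
  set d := dotv _ _ in d0.
  have [N hN] : exists N : nat, C < N.+1%:R * (d / 2).
    exists (Num.truncn (C / (d / 2))); rewrite -ltr_pdivrMr ?divr_gt0 //.
    by rewrite truncnS_gt.
  have nV : nbhs v [set u : 'cV[R]_m | d / 2 < dotv (x - a) u].
    have cv : {for v, continuous (fun u => dotv (x - a) u)}.
      have -> : (fun u => dotv (x - a) u) = (fun u => dotv u (x - a)).
        by apply/funext => u; rewrite dotvC.
      exact: dotv_continuous.
    apply: (cvgr_gt _ cv); by rewrite -/d; lra.
  have [k Nk /= hk] := clN N _ nV.
  have [_ _ /(_ x Sx) h] := hmu k.
  have : k.+1%:R^-1 * C < d / 2.
    rewrite mulrC ltr_pdivrMr // mulrC; apply: lt_le_trans hN _.
    by rewrite ler_wpM2r ?ler_nat // divr_ge0 // ltW.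
  by move=> h2; have := lt_trans (lt_le_trans hk h) h2; rewrite ltxx.
have C1 : 0 < C + 1 by lra.
(* For [mu k] this close to [nu], [dotv (z k) nu > - e], against the choice of [z k]. *)
have [k _ hk] := clN 0%N _ (nbhsx_ballx v _ (divr_gt0 e0 C1)).
move: hk; rewrite -ball_normE /= vnu => hk.
have [zM ze _] := hz k; have [_ zmu _] := hmu k.
have : `|dotv (z k) (nu - mu k)| < e.
  apply: le_lt_trans (dotv_le _ _) _.
  apply: le_lt_trans (_ : C * `|nu - mu k| < _); first by rewrite ler_wpM2r // ler_wpM2l.
  apply: le_lt_trans (_ : (C + 1) * `|nu - mu k| < _); first by rewrite ler_wpM2r //; lra.
  by rewrite mulrC -ltr_pdivlMr.
rewrite dotvBr ltr_norml => /andP[]; lra.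
Qed.

End ConvexBody.

(** * Invariance under a half-space of values *)

Section HalfSpace.
Variables (R : realType) (n : nat).

Lemma open_half_space : open (half_space R n).
Proof.
apply: (@open_comp _ _ (fun x : 'cV[R]_n.+1 => x ord_max 0) [set y | 0 < y]).
  by move=> x _; exact: coord_continuous.
exact: open_gt.
Qed.

Lemma closure_half_space (x : 'cV[R]_n.+1) :
  closure (half_space R n) x <-> 0 <= x ord_max 0.
Proof.
split.
  pose C := [set x : 'cV[R]_n.+1 | 0 <= x ord_max 0].
  have cC : closed C.
    apply: (@preimage_closed _ _ (fun x : 'cV[R]_n.+1 => x ord_max 0) [set y | 0 <= y]).
      by move=> y _; exact: coord_continuous.
    exact: closed_ge.
  have : closure (half_space R n) `<=` closure C.
    by apply: closureS => y /ltW.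
  by move/(_ x); rewrite -(closure_id C).1.
move=> x0; apply/closure_normP => e e0.
exists (x + (e / 2) *: delta_mx ord_max 0).
  by rewrite /half_space /= !mxE !eqxx mulr1; lra.
rewrite opprD addNKr normrN normrZ gtr0_norm ?divr_gt0 //.
apply: le_lt_trans (_ : e / 2 * 1 < e); last by lra.
rewrite ler_wpM2l //; first by rewrite divr_ge0 // ltW.
apply: norm_le_coord => // i; rewrite mxE.
by case: (_ && _); rewrite ?normr1 ?normr0.
Qed.

Lemma boundary_half_space (x : 'cV[R]_n.+1) :
  boundary (half_space R n) x <-> x ord_max 0 = 0.
Proof.
rewrite /boundary /setD /= closure_half_space.
rewrite (interior_id (half_space R n)).1; last exact: open_half_space.
rewrite /half_space /=; split=> [[x0 nx]|->]; last by rewrite lexx ltxx.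
by apply/eqP; rewrite eq_le x0 andbT leNgt; apply/negP.
Qed.

End HalfSpace.

(** * Sums and affine images of C2 maps *)

Section GlobalC2.
Variables (R : realType) (n m : nat).
Implicit Types u w : 'cV[R]_n -> 'cV[R]_m.

Lemma C2_onW (D : set 'cV[R]_n) u : C2_on setT u -> C2_on D u.
Proof.
by move=> [c0 c1 c2]; split=> [x _|k x _|j k x _]; [exact: c0|exact: c1|exact: c2].
Qed.

Lemma pdD k u w : (forall x, derivable u x (delta_mx k 0)) ->
  (forall x, derivable w x (delta_mx k 0)) ->
  pd k (fun x => u x + w x) = (fun x => pd k u x + pd k w x).
Proof. by move=> du dw; apply/funext => x; rewrite /pd deriveD. Qed.

Lemma pd_affine k a (t : R) u : (forall x, derivable u x (delta_mx k 0)) ->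
  pd k (fun x => a + t *: u x) = (fun x => t *: pd k u x).
Proof.
move=> du; apply/funext => x; rewrite /pd.
rewrite (@deriveD _ _ _ (cst a) (fun x => t *: u x)) ?derive_cst ?add0r.
- by rewrite (@deriveZ _ _ _ u).
- exact: derivable_cst.
- exact: (@derivableZ _ _ _ u).
Qed.

Lemma C2_onD u w : C2_on setT u -> C2_on setT w -> C2_on setT (fun x => u x + w x).
Proof.
move=> [u0 u1 u2] [w0 w1 w2].
have pd1 k : pd k (fun x => u x + w x) = (fun x => pd k u x + pd k w x).
  by apply: pdD => x; [have [] := u1 k x I|have [] := w1 k x I].
have pd2 j k : pd j (pd k (fun x => u x + w x)) =
    (fun x => pd j (pd k u) x + pd j (pd k w) x).
  by rewrite pd1; apply: pdD => x; [have [] := u2 j k x I|have [] := w2 j k x I].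
split=> [x _|k x _|j k x _].
- exact: (@cvgD _ _ _ (nbhs x) _ u w _ _ (u0 x I) (w0 x I)).
- have [du cu] := u1 k x I; have [dw cw] := w1 k x I; rewrite pd1; split.
    exact: (@derivableD _ _ _ u w).
  exact: (@cvgD _ _ _ (nbhs x) _ (pd k u) (pd k w) _ _ cu cw).
- have [du cu] := u2 j k x I; have [dw cw] := w2 j k x I; rewrite pd2 pd1; split.
    exact: (@derivableD _ _ _ (pd k u) (pd k w)).
  exact: (@cvgD _ _ _ (nbhs x) _ (pd j (pd k u)) (pd j (pd k w)) _ _ cu cw).
Qed.

Lemma C2_on_affine a (t : R) u : C2_on setT u -> C2_on setT (fun x => a + t *: u x).
Proof.
move=> [u0 u1 u2].
have pd1 k : pd k (fun x => a + t *: u x) = (fun x => t *: pd k u x).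
  by apply: pd_affine => x; have [] := u1 k x I.
have pd2 j k : pd j (pd k (fun x => a + t *: u x)) = (fun x => t *: pd j (pd k u) x).
  rewrite pd1 -[in LHS](_ : (fun x => 0 + t *: pd k u x) = (fun x => t *: pd k u x)).
    by apply: pd_affine => x; have [] := u2 j k x I.
  by apply/funext => x; rewrite add0r.
split=> [x _|k x _|j k x _].
- apply: (@cvgD _ _ _ (nbhs x) _ (cst a) (fun x => t *: u x)); first exact: cvg_cst.
  exact: (@cvgZl_tmp _ _ _ (nbhs x) _ t u _ (u0 x I)).
- have [du cu] := u1 k x I; rewrite pd1; split.
    apply: (@derivableD _ _ _ (cst a) (fun x => t *: u x)); first exact: derivable_cst.
    exact: (@derivableZ _ _ _ u).
  exact: (@cvgZl_tmp _ _ _ (nbhs x) _ t (pd k u) _ cu).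
- have [du cu] := u2 j k x I; rewrite pd2 pd1; split.
    exact: (@derivableZ _ _ _ (pd k u)).
  exact: (@cvgZl_tmp _ _ _ (nbhs x) _ t (pd j (pd k u)) _ cu).
Qed.

Lemma system_opD (A : 'I_n -> 'I_n -> 'M[R]_m) u w x :
  C2_on setT u -> C2_on setT w ->
  system_op A (fun x => u x + w x) x = system_op A u x + system_op A w x.
Proof.
move=> [u0 u1 u2] [w0 w1 w2].
rewrite /system_op -big_split; apply: eq_bigr => j _ /=.
rewrite -big_split; apply: eq_bigr => k _ /=.
rewrite -mulmxDr; congr (_ *m _).
have -> : pd k (fun x => u x + w x) = (fun x => pd k u x + pd k w x).
  by apply: pdD => y; [have [] := u1 k y I|have [] := w1 k y I].
by rewrite pdD // => y; [have [] := u2 j k y I|have [] := w2 j k y I].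
Qed.

Lemma system_op_affine (A : 'I_n -> 'I_n -> 'M[R]_m) a (t : R) u x :
  C2_on setT u -> system_op A (fun x => a + t *: u x) x = t *: system_op A u x.
Proof.
move=> [u0 u1 u2].
rewrite /system_op scaler_sumr; apply: eq_bigr => j _ /=.
rewrite scaler_sumr; apply: eq_bigr => k _ /=; rewrite scalemxAr.
congr (_ *m _); rewrite pd_affine; last by move=> y; have [] := u1 k y I.
rewrite -[in LHS](_ : (fun x => 0 + t *: pd k u x) = (fun x => t *: pd k u x)).
  by rewrite pd_affine // => y; have [] := u2 j k y I.
by apply/funext => y; rewrite add0r.
Qed.

End GlobalC2.

(** * From the body to its supporting half-space at a unique normal *)

Section InvariantHalfSpace.
Variables (R : realType) (n m : nat).
Variables (A : 'I_n.+1 -> 'I_n.+1 -> 'M[R]_m) (S : set 'cV[R]_m).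
Hypothesis S_body : convex_body S.
Hypothesis S_inv : invariant_set A (half_space R n) S.
Variables (a nu : 'cV[R]_m).
Hypothesis a_nu : unit_outward_normal S a nu.

(* [S] is invariant, so is [{z | dotv z nu <= 0}]: shift [u] by [- e nu] and shrink
   it towards [a] so that its boundary values land in [S]. *)
Lemma invariant_normal_le0 (u : 'cV[R]_n.+1 -> 'cV[R]_m) (M : R) :
  C2_on setT u ->
  (forall x : 'cV[R]_n.+1, 0 <= x ord_max 0 -> `|u x| <= M) ->
  (forall x : 'cV[R]_n.+1, 0 < x ord_max 0 -> system_op A u x = 0) ->
  (forall x : 'cV[R]_n.+1, x ord_max 0 = 0 -> dotv (u x) nu <= 0) ->
  forall x : 'cV[R]_n.+1, 0 < x ord_max 0 -> dotv (u x) nu <= 0.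
Proof.
move=> u2 uM uA ub x x0; have [_ [nu1 nuS] _] := a_nu.
apply/ler_addgt0Pr => e e0; rewrite add0r.
(* [M + e * |nu|] bounds the norm of [u y - e nu], and on the boundary the product of this vector
   with [nu] is at most [- e]. *)
have [t t0 ht] := unique_normal_absorbs S_body (M + e * `|nu|) a_nu e0.
pose v x := (a - (t * e) *: nu) + t *: u x.
have vE y : v y = a + t *: (u y - e *: nu).
  by rewrite /v scalerBr scalerA addrAC addrA.
have nn : dotv nu nu = 1 by exact/elength1.
have : S (v x).
  apply: (S_inv (u := v)); last exact: x0.
  - by apply: C2_onW; exact: C2_on_affine.
  - apply: continuous_subspaceT => y.
    by have [h _ _] := C2_on_affine (a - (t * e) *: nu) t u2; exact: h.
  - exists (`|a - (t * e) *: nu| + t * M); split; first exact: num_real.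
    move=> B BM y /= /closure_half_space y0; apply: le_trans (ltW BM).
    rewrite /v; apply: le_trans (ler_normD _ _) _; rewrite lerD2l normrZ gtr0_norm //.
    by rewrite ler_wpM2l ?uM // ltW.
  - move=> y y0; rewrite system_op_affine // uA ?scaler0 //.
  - move=> y /boundary_half_space y0; rewrite vE; apply: ht.
      apply: le_trans (ler_normB _ _) _.
      by rewrite normrZ gtr0_norm // lerD2r uM // y0.
    by rewrite dotvBl dotvZl nn mulr1 -[leRHS]add0r lerD2r ub.
move=> /nuS; rewrite vE addrAC subrr add0r dotvZl pmulr_rle0 //.
by rewrite dotvBl dotvZl nn mulr1 subr_le0.
Qed.

(** The one-sided statement, applied to [u] and to [- u]. *)
Lemma invariant_normal_eq0 (u : 'cV[R]_n.+1 -> 'cV[R]_m) (M : R) :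
  C2_on setT u ->
  (forall x : 'cV[R]_n.+1, 0 <= x ord_max 0 -> `|u x| <= M) ->
  (forall x : 'cV[R]_n.+1, 0 < x ord_max 0 -> system_op A u x = 0) ->
  (forall x : 'cV[R]_n.+1, x ord_max 0 = 0 -> dotv (u x) nu = 0) ->
  forall x : 'cV[R]_n.+1, 0 < x ord_max 0 -> dotv (u x) nu = 0.
Proof.
move=> u2 uM uA ub x x0; apply/eqP; rewrite eq_le; apply/andP; split.
  by apply: (invariant_normal_le0 u2 uM uA) => // y /ub ->.
pose w x := 0 + (-1) *: u x; have wE y : w y = - u y by rewrite /w add0r scaleN1r.
rewrite -oppr_le0 -dotvNl -wE; apply: (@invariant_normal_le0 w M); last exact: x0.
- exact: C2_on_affine.
- by move=> y /uM; rewrite wE normrN.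
- by move=> y /uA h; rewrite system_op_affine // h scaler0.
- by move=> y /ub h; rewrite wE dotvNl h oppr0.
Qed.

End InvariantHalfSpace.

(** * Exponential solutions *)

Section ExponentialSolutions.
Local Open Scope complex_scope.
Local Open Scope ring_scope.
Variables (R : realType) (n m : nat).
Local Notation C := R[i].
Implicit Types (zeta : 'I_n.+1 -> C) (w v : 'cV[C]_m) (x : 'cV[R]_n.+1).

Definition lin (a : 'I_n.+1 -> R) x := \sum_k a k * x k 0.

Definition reV (w : 'cV[C]_m) : 'cV[R]_m := map_mx (@Re R) w.
Definition imV (w : 'cV[C]_m) : 'cV[R]_m := map_mx (@Im R) w.

(** [ecos] and [esin] are the real and imaginary parts of [exp (i zeta.x)]. *)
Definition ecos zeta x :=
  expR (- lin (fun k => Im (zeta k)) x) * cos (lin (fun k => Re (zeta k)) x).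
Definition esin zeta x :=
  expR (- lin (fun k => Im (zeta k)) x) * sin (lin (fun k => Re (zeta k)) x).

(* The real part of [exp (i zeta.x) (w + i x_n v)]. *)
Definition expsol zeta w v x : 'cV[R]_m :=
  ecos zeta x *: (reV w - x ord_max 0 *: imV v) -
  esin zeta x *: (imV w + x ord_max 0 *: reV v).

Lemma lin_continuous a : continuous (lin a).
Proof.
move=> x; apply: (@cvg_sum _ _ _ (nbhs x)) => k.
by apply: cvgM; [exact: cvg_cst|exact: coord_continuous].
Qed.

Lemma lin_line a (h : R) k x : lin a (h *: delta_mx k 0 + x) = h * a k + lin a x.
Proof.
rewrite /lin (bigD1 k) //= [X in _ = _ + X](bigD1 k) //= !mxE !eqxx mulr1 mulrDr addrA.
rewrite (mulrC (a k) h); congr (_ + _); apply: eq_bigr => j jk.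
by rewrite !mxE (negbTE jk) mulr0 add0r.
Qed.

Lemma continuous_compose (T : topologicalType) (f : T -> R) (g : R -> R) :
  continuous f -> continuous g -> continuous (fun y => g (f y)).
Proof. by move=> cf cg y; exact: (continuous_comp (cf y) (cg (f y))). Qed.

Lemma ecos_continuous zeta : continuous (ecos zeta).
Proof.
pose f := lin (fun k => Re (zeta k)); pose g x := - lin (fun k => Im (zeta k)) x.
have cf : continuous f by exact: lin_continuous.
have cg : continuous g.
  by move=> x; apply: (@cvgN _ _ _ (nbhs x)); exact: lin_continuous.
have c1 := @continuous_compose _ g (@expR R) cg (@continuous_expR R).
have c2 := @continuous_compose _ f (@cos R) cf (@continuous_cos R).
by move=> x; exact: (@cvgM _ _ (nbhs x) _ _ _ _ _ (c1 x) (c2 x)).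
Qed.

Lemma esin_continuous zeta : continuous (esin zeta).
Proof.
pose f := lin (fun k => Re (zeta k)); pose g x := - lin (fun k => Im (zeta k)) x.
have cf : continuous f by exact: lin_continuous.
have cg : continuous g.
  by move=> x; apply: (@cvgN _ _ _ (nbhs x)); exact: lin_continuous.
have c1 := @continuous_compose _ g (@expR R) cg (@continuous_expR R).
have c2 := @continuous_compose _ f (@sin R) cf (@continuous_sin R).
by move=> x; exact: (@cvgM _ _ (nbhs x) _ _ _ _ _ (c1 x) (c2 x)).
Qed.

Lemma expsol_continuous zeta w v : continuous (expsol zeta w v).
Proof.
have cl (p q : 'cV[R]_m) : continuous (fun x : 'cV[R]_n.+1 => p + x ord_max 0 *: q).
  move=> x; apply: (@cvgD _ _ _ (nbhs x) _ (cst p) (fun x => x ord_max 0 *: q)).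
    exact: cvg_cst.
  apply: (@cvgZr_tmp _ _ _ (nbhs x) _ (fun x : 'cV[R]_n.+1 => x ord_max 0)).
  exact: coord_continuous.
have -> : expsol zeta w v = (fun x =>
    ecos zeta x *: (reV w + x ord_max 0 *: (- imV v)) +
    (- esin zeta x) *: (imV w + x ord_max 0 *: reV v)).
  by apply/funext => x; rewrite /expsol scalerN scaleNr.
move=> x; apply: (@cvgD _ _ _ (nbhs x) _
  (fun x => ecos zeta x *: (reV w + x ord_max 0 *: (- imV v)))
  (fun x => (- esin zeta x) *: (imV w + x ord_max 0 *: reV v))).
  apply: (@cvgZ _ _ _ (nbhs x) _ (ecos zeta)
    (fun x => reV w + x ord_max 0 *: (- imV v))).
    exact: ecos_continuous.
  exact: cl.
apply: (@cvgZ _ _ _ (nbhs x) _ (fun x => - esin zeta x)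
  (fun x => imV w + x ord_max 0 *: reV v)); last exact: cl.
by apply: (@cvgN _ _ _ (nbhs x)); exact: esin_continuous.
Qed.

Lemma is_derive_line (V W : normedModType R) (f : V -> W) (x v : V) (df : W) :
  is_derive (0 : R) 1 (fun h : R => f (h *: v + x)) df -> is_derive x v f df.
Proof.
move=> dfx; have d := (derivable1P f x v).2 (@ex_derive _ _ _ _ _ _ _ dfx).
apply: (DeriveDef d); rewrite -[RHS](@derive_val _ _ _ _ _ _ _ dfx).
rewrite /derive; set g1 := fun h => h^-1 *: _; set g2 := fun h => h^-1 *: _.
suff -> : g1 = g2 by []; rewrite funeqE /g1 /g2 => h /=.
by rewrite addr0 scale0r add0r [_%:A]mulr1.
Qed.

(** One coordinate of [expsol] along the line [x + h e_k]: [a], [b] are the real and imaginary parts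
    of [zeta k], [A], [B] those of [zeta.x], [X] is [x_n], and [d] is 1 if [k] is the last index and
    0 otherwise. *)
Lemma is_derive_expsol1 (A B a b p q p' q' X d : R) :
  is_derive (0 : R) 1 (fun h : R =>
    expR (- (h * b + B)) * cos (h * a + A) * (p - (h * d + X) * q) -
    expR (- (h * b + B)) * sin (h * a + A) * (p' + (h * d + X) * q'))
  (expR (- B) * cos A * (- b * (p - X * q) - a * (p' + X * q') - d * q) -
   expR (- B) * sin A * (a * (p - X * q) - b * (p' + X * q') + d * q')).
Proof.
have dM (f g : R -> R) (df dg l : R) : is_derive (0 : R) 1 f df ->
    is_derive (0 : R) 1 g dg -> f 0 * dg + g 0 * df = l ->
    is_derive (0 : R) 1 (fun h => f h * g h) l.
  by move=> hf hg <-; exact: (@is_deriveM _ _ f g).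
have dD (f g : R -> R) (df dg l : R) : is_derive (0 : R) 1 f df ->
    is_derive (0 : R) 1 g dg -> df + dg = l ->
    is_derive (0 : R) 1 (fun h => f h + g h) l.
  by move=> hf hg <-; exact: (@is_deriveD _ _ _ f g).
have dN (f : R -> R) (df : R) : is_derive (0 : R) 1 f df ->
    is_derive (0 : R) 1 (fun h => - f h) (- df).
  by move=> hf; exact: (@is_deriveN _ _ _ f).
have dc0 (t : R) : is_derive (0 : R) 1 (fun=> t) 0 by exact: is_derive_cst.
have dl (s t : R) : is_derive (0 : R) 1 (fun h : R => h * s + t) s.
  have e : 0 * 0 + s * 1 = s :> R by rewrite mul0r add0r mulr1.
  have dh := dM id (fun=> s) 1 0 s (is_derive_id (0 : R) (1 : R)) (dc0 s) e.
  exact: (dD (fun h => h * s) (fun=> t) s 0 s dh (dc0 t) (addr0 s)).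
have dcomp (f g : R -> R) (df dg l : R) : is_derive (0 : R) 1 f df ->
    is_derive (f 0) 1 g dg -> df * dg = l ->
    is_derive (0 : R) 1 (fun h => g (f h)) l.
  by move=> hf hg <-; rewrite mulrC; exact: (@is_derive1_comp R g f 0 dg df hg hf).
have de : is_derive (0 : R) 1 (fun h : R => expR (- (h * b + B))) (- b * expR (- B)).
  have e : is_derive (- (0 * b + B)) 1 (@expR R) (expR (- B)).
    by rewrite mul0r add0r; exact: is_derive_expR.
  exact: (dcomp (fun h => - (h * b + B)) _ _ _ _ (dN _ _ (dl b B)) e erefl).
have dc : is_derive (0 : R) 1 (fun h : R => cos (h * a + A)) (a * - sin A).
  have e : is_derive (0 * a + A) 1 (@cos R) (- sin A).
    by rewrite mul0r add0r; exact: is_derive_cos.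
  exact: (dcomp (fun h => h * a + A) _ _ _ _ (dl a A) e erefl).
have ds : is_derive (0 : R) 1 (fun h : R => sin (h * a + A)) (a * cos A).
  have e : is_derive (0 * a + A) 1 (@sin R) (cos A).
    by rewrite mul0r add0r; exact: is_derive_sin.
  exact: (dcomp (fun h => h * a + A) _ _ _ _ (dl a A) e erefl).
have dp (s : R) : is_derive (0 : R) 1 (fun h : R => (h * d + X) * s) (d * s).
  have e : (0 * d + X) * 0 + s * d = d * s by rewrite mulr0 add0r mulrC.
  exact: (dM (fun h => h * d + X) (fun=> s) d 0 _ (dl d X) (dc0 s) e).
have dq1 := dD _ _ _ _ _ (dc0 p) (dN _ _ (dp q)) erefl.
have dq2 := dD _ _ _ _ _ (dc0 p') (dp q') erefl.
have t1 := dM _ _ _ _ _ (dM _ _ _ _ _ de dc erefl) dq1 erefl.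
have t2 := dM _ _ _ _ _ (dM _ _ _ _ _ de ds erefl) dq2 erefl.
apply: (dD _ _ _ _ _ t1 (dN _ _ t2)).
by rewrite /= !mul0r !add0r; ring.
Qed.

Lemma is_derive_cV (V : normedModType R) (f : V -> 'cV[R]_m) (x v : V)
    (df : 'cV[R]_m) :
  (forall i, is_derive x v (fun y => f y i 0) (df i 0)) -> is_derive x v f df.
Proof.
move=> h; have d : derivable f x v.
  by apply/derivable_mxP => i j; rewrite (ord1 j); exact: (@ex_derive _ _ _ _ _ _ _ (h i)).
apply: (DeriveDef d); rewrite derive_mx //; apply/colP => i; rewrite mxE.
exact: (@derive_val _ _ _ _ _ _ _ (h i)).
Qed.

(** The family is closed under partial derivatives, so the system can be evaluated on the
    coefficients [w] and [v] alone. *)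
Lemma is_derive_expsol zeta w v k x :
  is_derive x (delta_mx k 0) (expsol zeta w v)
    (expsol zeta (('i%C * zeta k) *: w + ('i%C * (ord_max == k)%:R) *: v)
       (('i%C * zeta k) *: v) x).
Proof.
apply: is_derive_cV => i; apply: is_derive_line.
have -> : (fun h : R => expsol zeta w v (h *: delta_mx k 0 + x) i 0) =
  (fun h : R =>
    expR (- (h * Im (zeta k) + lin (fun k => Im (zeta k)) x)) *
      cos (h * Re (zeta k) + lin (fun k => Re (zeta k)) x) *
      (Re (w i 0) - (h * (ord_max == k)%:R + x ord_max 0) * Im (v i 0)) -
    expR (- (h * Im (zeta k) + lin (fun k => Im (zeta k)) x)) *
      sin (h * Re (zeta k) + lin (fun k => Re (zeta k)) x) *
      (Im (w i 0) + (h * (ord_max == k)%:R + x ord_max 0) * Re (v i 0))).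
  apply/funext => h; rewrite /expsol /ecos /esin !lin_line !mxE eqxx andbT.
  by rewrite !mulrDl.
apply: is_derive_eq (is_derive_expsol1 _ _ _ _ _ _ _ _ _ _) _.
rewrite /expsol /ecos /esin !mxE; set c := expR _ * _; set s := expR _ * _.
case: (w i 0) => w1 w2; case: (v i 0) => v1 v2; case: (zeta k) => a b /=.
by case: (_ == k) => /=; ring.
Qed.

Lemma pd_expsol zeta w v k :
  pd k (expsol zeta w v) =
  expsol zeta (('i%C * zeta k) *: w + ('i%C * (ord_max == k)%:R) *: v)
       (('i%C * zeta k) *: v).
Proof.
by apply/funext => x; exact: (@derive_val _ _ _ _ _ _ _ (is_derive_expsol _ _ _ _ _)).
Qed.

Lemma C2_on_expsol zeta w v : C2_on setT (expsol zeta w v).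
Proof.
split=> [x _|k x _|j k x _]; first exact: expsol_continuous.
- rewrite pd_expsol; split; last exact: expsol_continuous.
  exact: (@ex_derive _ _ _ _ _ _ _ (is_derive_expsol _ _ _ _ _)).
- rewrite !pd_expsol; split; last exact: expsol_continuous.
  exact: (@ex_derive _ _ _ _ _ _ _ (is_derive_expsol _ _ _ _ _)).
Qed.

Lemma expsolD zeta w1 v1 w2 v2 x :
  expsol zeta (w1 + w2) (v1 + v2) x = expsol zeta w1 v1 x + expsol zeta w2 v2 x.
Proof.
apply/colP => i; rewrite /expsol !mxE.
by case: (w1 i 0) (w2 i 0) (v1 i 0) (v2 i 0) => ? ? [? ?] [? ?] [? ?] /=; ring.
Qed.

Lemma expsol0 zeta x : expsol zeta 0 0 x = 0.
Proof. by apply/colP => i; rewrite /expsol !mxE /=; ring. Qed.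

Lemma expsol_sum (I : Type) (r : seq I) zeta (w v : I -> 'cV[C]_m) x :
  \sum_(i <- r) expsol zeta (w i) (v i) x =
  expsol zeta (\sum_(i <- r) w i) (\sum_(i <- r) v i) x.
Proof.
elim: r => [|i r IH]; first by rewrite !big_nil expsol0.
by rewrite !big_cons expsolD IH.
Qed.

Local Notation toC := (map_mx (real_complex R)).

Lemma mulmx_expsol (A : 'M[R]_m) zeta w v x :
  A *m expsol zeta w v x = expsol zeta (toC A *m w) (toC A *m v) x.
Proof.
have reM (u : 'cV[C]_m) : reV (toC A *m u) = A *m reV u.
  apply/colP => i; rewrite !mxE (raddf_sum (@Re R)); apply: eq_bigr => j _.
  by rewrite !mxE; case: (u j 0) => ? ? /=; rewrite mul0r subr0.
have imM (u : 'cV[C]_m) : imV (toC A *m u) = A *m imV u.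
  apply/colP => i; rewrite !mxE (raddf_sum (@Im R)); apply: eq_bigr => j _.
  by rewrite !mxE; case: (u j 0) => ? ? /=; rewrite mul0r addr0.
by rewrite /expsol !reM !imM !(mulmxBr, mulmxDr) -!scalemxAr !(mulmxBr, mulmxDr) -!scalemxAr.
Qed.

Variable A : 'I_n.+1 -> 'I_n.+1 -> 'M[R]_m.

Definition symbol zeta : 'M[C]_m :=
  \sum_j \sum_k (zeta j * zeta k) *: toC (A j k).
(** The derivative of [symbol] with respect to the last coordinate of [zeta]. *)
Definition dsymbol zeta : 'M[C]_m :=
  \sum_j \sum_k (zeta j * (ord_max == k)%:R + (ord_max == j)%:R * zeta k)
    *: toC (A j k).

(** The system turns the coefficients [(w, v)] into [- (symbol w + dsymbol v, symbol v)]; the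
    hypotheses say that [v, w] is a Jordan chain of the pencil. *)
Lemma system_op_expsol zeta w v x :
  symbol zeta *m v = 0 -> symbol zeta *m w + dsymbol zeta *m v = 0 ->
  system_op A (expsol zeta w v) x = 0.
Proof.
move=> hv hw; rewrite /system_op.
have iM (p q : C) : ('i%C * p) * ('i%C * q) = - (p * q).
  by rewrite mulrACA -expr2 sqr_i mulN1r.
under eq_bigr => j _ do under eq_bigr => k _ do rewrite !pd_expsol mulmx_expsol.
under eq_bigr => j _ do rewrite expsol_sum.
rewrite expsol_sum; set W := \sum_j _; set V := \sum_j _.
have -> : W = - (symbol zeta *m w + dsymbol zeta *m v).
  rewrite /W /symbol /dsymbol !mulmx_suml -big_split -sumrN; apply: eq_bigr => j _ /=.
  rewrite !mulmx_suml -big_split -sumrN; apply: eq_bigr => k _ /=.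
  rewrite -!scalemxAl !mulmxDr -!scalemxAr !mulmxDr -!scalemxAr.
  rewrite !scalerDr !scalerA !iM !scaleNr -addrA -opprD -opprD -scalerDl.
  by [].
have -> : V = - (symbol zeta *m v).
  rewrite /V /symbol !mulmx_suml -sumrN; apply: eq_bigr => j _ /=.
  rewrite !mulmx_suml -sumrN; apply: eq_bigr => k _ /=.
  by rewrite -!scalemxAl -!scalemxAr scalerA iM scaleNr.
by rewrite hw hv oppr0 expsol0.
Qed.

End ExponentialSolutions.

(** * Normal components of bounded exponential solutions *)

Section KeyVanishing.
Local Open Scope complex_scope.
Local Open Scope ring_scope.
Variables (R : realType) (n m : nat).
Local Notation C := R[i].
Implicit Types (zeta : 'I_n.+1 -> C) (w v : 'cV[C]_m) (x : 'cV[R]_n.+1).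

(** Real tangential frequencies and decay in [x_n]: this keeps [expsol] bounded in the
    half-space. *)
Definition upper zeta : Prop :=
  (forall k, k != ord_max -> Im (zeta k) = 0) /\ 0 < Im (zeta ord_max).

Lemma upper_lin zeta x : upper zeta ->
  lin (fun k => Im (zeta k)) x = Im (zeta ord_max) * x ord_max 0.
Proof.
move=> [h _]; rewrite /lin (bigD1 ord_max) //= big1 ?addr0 // => k /h ->.
by rewrite mul0r.
Qed.

(** The exponential absorbs the factor [x_n]: [exp y >= 1 + y] gives [exp (- b X) * X <= 1 / b]. *)
Lemma expsol_bounded zeta w v : upper zeta -> exists M : R,
  forall x, 0 <= x ord_max 0 -> `|expsol zeta w v x| <= M.
Proof.
move=> uz; have [_ b0] := uz; set b := Im _ in b0.
exists ((`|reV w| + `|imV v| / b) + (`|imV w| + `|reV v| / b)) => x x0.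
set X := x ord_max 0 in x0 *.
pose e := expR (- (b * X)).
have eE : expR (- lin (fun k => Im (zeta k)) x) = e by rewrite upper_lin.
have e0 : 0 <= e by exact: expR_ge0.
have bX : 0 <= b * X by rewrite mulr_ge0 // ltW.
have eX : e * (1 + b * X) <= 1.
  rewrite /e expRN mulrC ler_pdivrMr ?expR_gt0 // mul1r; exact: expR_ge1Dx.
have e1 : e <= 1 by nra.
have eX1 : e * X <= b^-1.
  rewrite -(ler_pM2l b0) mulfV ?gt_eqF //; nra.
have cb : `|ecos zeta x| <= e.
  by rewrite /ecos eE normrM (ger0_norm e0) ler_piMr // cos_max.
have sb : `|esin zeta x| <= e.
  by rewrite /esin eE normrM (ger0_norm e0) ler_piMr // sin_max.
have bound (c : R) (p q : 'cV[R]_m) (r : R) : `|c| <= e -> `|r| = X ->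
    `|c *: (p + r *: q)| <= `|p| + `|q| / b.
  move=> ce rX; rewrite normrZ.
  apply: le_trans (_ : e * (`|p| + X * `|q|) <= _).
    rewrite ler_pM //; apply: le_trans (ler_normD _ _) _.
    by rewrite lerD2l normrZ rX.
  have p0 := normr_ge0 p; have q0 := normr_ge0 q.
  rewrite mulrDr mulrA; apply: lerD; first by rewrite ler_piMl.
  by rewrite [leRHS]mulrC ler_wpM2r.
rewrite /expsol; apply: le_trans (ler_normB _ _) _; apply: lerD.
  by rewrite -scaleNr; apply: bound => //; rewrite normrN ger0_norm.
by apply: bound => //; rewrite ger0_norm.
Qed.

Definition cdot (w : 'cV[C]_m) (nu : 'cV[R]_m) : C := \sum_i w i 0 * (nu i 0)%:C.

Lemma cdotDl w v nu : cdot (w + v) nu = cdot w nu + cdot v nu.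
Proof. by rewrite -big_split; apply: eq_bigr => i _; rewrite mxE mulrDl. Qed.

Lemma cdotZl (c : C) w nu : cdot (c *: w) nu = c * cdot w nu.
Proof. by rewrite mulr_sumr; apply: eq_bigr => i _; rewrite mxE mulrA. Qed.

Lemma dotv_reV w nu : dotv (reV w) nu = Re (cdot w nu).
Proof.
rewrite (raddf_sum (@Re R)); apply: eq_bigr => i _; rewrite mxE.
by case: (w i 0) => a b /=; rewrite mulr0 subr0.
Qed.

Lemma dotv_imV w nu : dotv (imV w) nu = Im (cdot w nu).
Proof.
rewrite (raddf_sum (@Im R)); apply: eq_bigr => i _; rewrite mxE.
by case: (w i 0) => a b /=; rewrite mulr0 add0r.
Qed.

Lemma dotv_expsol zeta w v nu x : x ord_max 0 = 0 ->
  dotv (expsol zeta w v x) nu =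
  ecos zeta x * Re (cdot w nu) - esin zeta x * Im (cdot w nu).
Proof.
by move=> x0; rewrite /expsol x0 !scale0r subr0 addr0 dotvBl !dotvZl dotv_reV dotv_imV.
Qed.

(** The derivative is the limit of the quotients with [h > 0], all of which are orthogonal to [nu].
    Meant for a boundary point [x] and the inner direction [v]. *)
Lemma onesided_derive0 (V : normedModType R) (f : V -> 'cV[R]_m) (x v : V)
    (df nu : 'cV[R]_m) :
  is_derive x v f df -> dotv (f x) nu = 0 ->
  (forall h : R, 0 < h -> dotv (f (h *: v + x)) nu = 0) -> dotv df nu = 0.
Proof.
move=> hd fx fh; have d := @ex_derive _ _ _ _ _ _ _ hd.
have dE := @derive_val _ _ _ _ _ _ _ hd.
have c : h^-1 *: (f (h *: v + x) - f x) @[h --> (0 : R)^'] --> df.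
  by rewrite -dE; exact: d.
have c2 : dotv (h^-1 *: (f (h *: v + x) - f x)) nu @[h --> (0 : R)^'] --> dotv df nu.
  exact: (cvg_comp _ _ c (@dotv_continuous R m nu df)).
have c3 := cvg_dnbhs_at_right c2.
have c4 : dotv (h^-1 *: (f (h *: v + x) - f x)) nu @[h --> (0 : R)^'+] --> (0 : R).
  apply: cvg_near_cst; near=> h.
  by rewrite dotvZl dotvBl fx fh ?subrr ?mulr0 //; near: h; exact: nbhs_right_gt.
exact: (cvg_unique _ c3 c4).
Unshelve. all: by end_near. Qed.

Variables (A : 'I_n.+1 -> 'I_n.+1 -> 'M[R]_m) (S : set 'cV[R]_m).
Hypothesis S_body : convex_body S.
Hypothesis S_inv : invariant_set A (half_space R n) S.
Variable nu : 'cV[R]_m.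
Hypothesis nu_normal : unit_normals S nu.

(** On the boundary the two exponentials coincide, so the sum of the two solutions has zero product
    with [nu] there, hence also inside. Its derivative in [x_n] at the origin therefore has zero
    product with [nu] as well, and that product is minus the imaginary part in question. *)
Lemma invariant_exp_vanish_Im zeta1 zeta2 w1 v1 w2 v2 :
  upper zeta1 -> upper zeta2 ->
  (forall k, k != ord_max -> Re (zeta1 k) = Re (zeta2 k)) ->
  symbol A zeta1 *m v1 = 0 -> symbol A zeta1 *m w1 + dsymbol A zeta1 *m v1 = 0 ->
  symbol A zeta2 *m v2 = 0 -> symbol A zeta2 *m w2 + dsymbol A zeta2 *m v2 = 0 ->
  cdot (w1 + w2) nu = 0 ->
  Im (cdot ((zeta1 ord_max *: w1 + v1) + (zeta2 ord_max *: w2 + v2)) nu) = 0.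
Proof.
move=> u1 u2 re12 hv1 hw1 hv2 hw2 h0; have [a a_nu] := nu_normal.
pose u x := expsol zeta1 w1 v1 x + expsol zeta2 w2 v2 x.
have u_C2 : C2_on setT u by apply: C2_onD; exact: C2_on_expsol.
have [M1 hM1] := expsol_bounded w1 v1 u1.
have [M2 hM2] := expsol_bounded w2 v2 u2.
have uM x : 0 <= x ord_max 0 -> `|u x| <= M1 + M2.
  move=> x0; apply: le_trans (ler_normD _ _) _.
  by apply: lerD; [exact: hM1|exact: hM2].
have uA x : 0 < x ord_max 0 -> system_op A u x = 0.
  move=> _; rewrite system_opD; [|exact: C2_on_expsol..].
  by rewrite !system_op_expsol // addr0.
have ub x : x ord_max 0 = 0 -> dotv (u x) nu = 0.
  move=> x0; rewrite dotvDl !dotv_expsol //.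
  have lre : lin (fun k => Re (zeta1 k)) x = lin (fun k => Re (zeta2 k)) x.
    apply: eq_bigr => k _; have [->|kn] := eqVneq k ord_max; first by rewrite x0 !mulr0.
    by rewrite re12.
  have -> : ecos zeta1 x = ecos zeta2 x.
    by rewrite /ecos !upper_lin // x0 !mulr0 lre.
  have -> : esin zeta1 x = esin zeta2 x.
    by rewrite /esin !upper_lin // x0 !mulr0 lre.
  move: h0; rewrite cdotDl; case: (cdot w1 nu) (cdot w2 nu) => c1 d1 [c2 d2].
  by move=> [h1 h2] /=; rewrite addrACA -mulrDr -opprD -mulrDr h1 h2 !mulr0 subr0.
have uin := invariant_normal_eq0 S_body S_inv a_nu u_C2 uM uA ub.
pose w1' := ('i%C * zeta1 ord_max) *: w1 + ('i%C * (ord_max == ord_max :> 'I_n.+1)%:R) *: v1.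
pose w2' := ('i%C * zeta2 ord_max) *: w2 + ('i%C * (ord_max == ord_max :> 'I_n.+1)%:R) *: v2.
pose v1' := ('i%C * zeta1 ord_max) *: v1.
pose v2' := ('i%C * zeta2 ord_max) *: v2.
have du : is_derive (0 : 'cV[R]_n.+1) (delta_mx ord_max 0) u
    (expsol zeta1 w1' v1' 0 + expsol zeta2 w2' v2' 0).
  exact: (@is_deriveD _ _ _ (expsol zeta1 w1 v1) (expsol zeta2 w2 v2) _ _ _ _
    (is_derive_expsol _ _ _ _ _) (is_derive_expsol _ _ _ _ _)).
have zn : (0 : 'cV[R]_n.+1) ord_max 0 = 0 by rewrite mxE.
have := onesided_derive0 du (ub _ zn).
have lin0 b : lin b (0 : 'cV[R]_n.+1) = 0.
  by rewrite /lin big1 // => k _; rewrite mxE mulr0.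
rewrite dotvDl !dotv_expsol // /ecos /esin !lin0 oppr0 expR0 cos0 sin0.
rewrite !mul1r !mul0r !subr0.
have iD (K : C) : Re ('i%C * K) = - Im K by case: K => ? ? /=; ring.
have wE (z : C) (w v : 'cV[C]_m) :
    Re (cdot (('i%C * z) *: w + ('i%C * (ord_max == ord_max :> 'I_n.+1)%:R) *: v) nu) =
    - Im (cdot (z *: w + v) nu).
  rewrite eqxx mulr1 -iD !cdotDl !cdotZl; congr Re; ring.
rewrite /w1' /w2' !wE [in X in _ -> X]cdotDl => h.
have {h} : - Im (cdot (zeta1 ord_max *: w1 + v1) nu) - Im (cdot (zeta2 ord_max *: w2 + v2) nu) = 0.
  apply: h => r r0; apply: uin; by rewrite addr0 !mxE !eqxx mulr1.
rewrite -opprD => /eqP; rewrite oppr_eq0 => /eqP <-.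
by rewrite (raddfD (@Im R)).
Qed.

Lemma invariant_exp_vanish zeta1 zeta2 w1 v1 w2 v2 :
  upper zeta1 -> upper zeta2 ->
  (forall k, k != ord_max -> Re (zeta1 k) = Re (zeta2 k)) ->
  symbol A zeta1 *m v1 = 0 -> symbol A zeta1 *m w1 + dsymbol A zeta1 *m v1 = 0 ->
  symbol A zeta2 *m v2 = 0 -> symbol A zeta2 *m w2 + dsymbol A zeta2 *m v2 = 0 ->
  cdot (w1 + w2) nu = 0 ->
  cdot ((zeta1 ord_max *: w1 + v1) + (zeta2 ord_max *: w2 + v2)) nu = 0.
Proof.
move=> u1 u2 re12 hv1 hw1 hv2 hw2 h0; set K := cdot _ _.
have ImK : Im K = 0 by exact: invariant_exp_vanish_Im.
(* The same for the data multiplied by [i]. *)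
have ImiK : Im ('i%C * K) = 0.
  rewrite /K -cdotZl !scalerDr !scalerA ![ 'i%C * zeta1 _]mulrC ![ 'i%C * zeta2 _]mulrC.
  rewrite -!scalerA; apply: invariant_exp_vanish_Im => //.
  - by rewrite -scalemxAr hv1 scaler0.
  - by rewrite -!scalemxAr -scalerDr hw1 scaler0.
  - by rewrite -scalemxAr hv2 scaler0.
  - by rewrite -!scalemxAr -scalerDr hw2 scaler0.
  - by rewrite -scalerDr cdotZl h0 mulr0.
have iI (z : C) : Im ('i%C * z) = Re z by case: z => a b /=; ring.
by apply/eqP; rewrite eq_complex -(iI K) ImiK ImK !eqxx.
Qed.

End KeyVanishing.

(** * Necessity *)

Section Pencil.
Local Open Scope complex_scope.
Local Open Scope ring_scope.
Variables (R : realType) (n m : nat).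
Local Notation C := R[i].
Local Notation toC := (map_mx (real_complex R)).
Variable A : 'I_n.+1 -> 'I_n.+1 -> 'M[R]_m.+1.
Hypothesis A_elliptic : strongly_elliptic A.

Local Notation dlt k := ((ord_max == k :> 'I_n.+1)%:R).

Lemma strongly_elliptic_inj (s : 'I_n.+1 -> R) (z : 'cV[R]_m.+1) :
  (exists k, s k != 0) -> (\sum_j \sum_k (s j * s k) *: A j k) *m z = 0 -> z = 0.
Proof.
move=> [k0 sk0] Az; have [d d0 hd] := A_elliptic.
pose sv : 'cV[R]_n.+1 := \col_k s k.
have := hd sv z; set P := (\sum_j _) in Az.
have -> : \sum_j \sum_k (sv j 0 * sv k 0) *: A j k = P.
  by apply: eq_bigr => j _; apply: eq_bigr => k _; rewrite !mxE.
rewrite Az dotv0l /elength !sqr_sqrtr ?dotv_ge0 // => h.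
apply: dotv_eq0; apply/eqP; rewrite eq_le dotv_ge0 andbT.
rewrite -(pmulr_rle0 _ (_ : 0 < d * dotv sv sv)) // mulr_gt0 //.
apply: lt_le_trans (sqr_coord_le_dotv sv k0).
by rewrite mxE lt_neqAle sqr_ge0 andbT eq_sym sqrf_eq0.
Qed.

Variable xi : 'I_n.+1 -> R.
Hypothesis xi_last : xi ord_max = 0.
Hypothesis xi_neq0 : exists k, xi k != 0.

(** The frequency [xi + t e_n]; there the symbol is the pencil
    [pencil0 + t pencil1 + t^2 pencil2]. *)
Definition pencil_pt (t : C) (k : 'I_n.+1) : C := (xi k)%:C + t * dlt k.

Definition pencil0 : 'M[R]_m.+1 := \sum_j \sum_k (xi j * xi k) *: A j k.
Definition pencil1 : 'M[R]_m.+1 :=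
  \sum_j \sum_k (xi j * dlt k + dlt j * xi k) *: A j k.
Definition pencil2 : 'M[R]_m.+1 := A ord_max ord_max.

Lemma sum_dlt : \sum_j \sum_k (dlt j * dlt k) *: A j k = pencil2.
Proof.
rewrite (bigD1 ord_max) //= (bigD1 ord_max) //= eqxx mulr1 scale1r.
rewrite big1 ?addr0 => [|k /negbTE kn]; last by rewrite eq_sym kn mulr0 scale0r.
rewrite big1 ?addr0 // => j /negbTE jn; rewrite big1 // => k _.
by rewrite eq_sym jn mul0r scale0r.
Qed.

Lemma symbol_pencil t : symbol A (pencil_pt t) =
  toC pencil0 + t *: toC pencil1 + t ^+ 2 *: toC pencil2.
Proof.
rewrite -sum_dlt /symbol /pencil0 /pencil1 !raddf_sum -!big_split.
apply: eq_bigr => j _ /=; rewrite !raddf_sum -!big_split.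
apply: eq_bigr => k _ /=; rewrite !map_mxZ !scalerA -!scalerDl; congr (_ *: _).
rewrite /pencil_pt !(rmorphD, rmorphM, rmorph_nat) /=; ring.
Qed.

Lemma dsymbol_pencil t : dsymbol A (pencil_pt t) =
  toC pencil1 + (2 * t) *: toC pencil2.
Proof.
rewrite -sum_dlt /dsymbol /pencil1 !raddf_sum -!big_split.
apply: eq_bigr => j _ /=; rewrite !raddf_sum -!big_split.
apply: eq_bigr => k _ /=; rewrite !map_mxZ !scalerA -!scalerDl; congr (_ *: _).
rewrite /pencil_pt !(rmorphD, rmorphM, rmorph_nat) /=; ring.
Qed.

(** Ellipticity at the frequency [e_n]. *)
Lemma pencil2_unit : pencil2 \in unitmx.
Proof.
rewrite -unitmx_tr -row_free_unit -kermx_eq0; apply/eqP/row_matrixP => i.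
rewrite row0; set v := row i _; have hv : v *m pencil2^T = 0.
  by apply/sub_kermxP; exact: row_sub.
apply: trmx_inj; rewrite trmx0.
apply: (@strongly_elliptic_inj (fun k => dlt k)).
  by exists ord_max; rewrite eqxx oner_eq0.
by rewrite sum_dlt; apply: trmx_inj; rewrite trmx_mul trmxK trmx0.
Qed.

(** For real [t] the frequency [xi + t e_n] is real and nonzero, since [xi] is tangential and
    nonzero; ellipticity then applies to the real and imaginary parts of [v]. *)
Lemma symbol_real_inj (t : C) (v : 'cV[C]_m.+1) : Im t = 0 ->
  symbol A (pencil_pt t) *m v = 0 -> v = 0.
Proof.
case: t => t ? /= -> hv.
pose s k := xi k + t * dlt k.
have sE : symbol A (pencil_pt t%:C) = toC (\sum_j \sum_k (s j * s k) *: A j k).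
  rewrite /symbol raddf_sum; apply: eq_bigr => j _ /=.
  rewrite raddf_sum; apply: eq_bigr => k _ /=; rewrite map_mxZ; congr (_ *: _).
  by rewrite /pencil_pt /s !(rmorphD, rmorphM, rmorph_nat).
have s0 : exists k, s k != 0.
  have [k xk] := xi_neq0; exists k; rewrite /s.
  have [kn|kn] := eqVneq ord_max k; last by rewrite mulr0 addr0.
  by move: xk; rewrite -kn xi_last eqxx.
have hz (z : 'cV[R]_m.+1) : (\sum_j \sum_k (s j * s k) *: A j k) *m z = 0 -> z = 0.
  exact: strongly_elliptic_inj.
rewrite -[symbol A _](_ : toC (\sum_j \sum_k (s j * s k) *: A j k) = _) // in hv.
set P := \sum_j _ in hv hz.
have r0 : map_mx (@Re R) v = 0.
  apply: hz; apply/colP => i; have /colP/(_ i) := hv; rewrite !mxE => /(congr1 (@Re R)) /=.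
  rewrite (raddf_sum (@Re R)) => h; rewrite -[RHS]h; apply: eq_bigr => j _.
  by rewrite !mxE; case: (v j 0) => ? ? /=; rewrite mul0r subr0.
have i0 : map_mx (@Im R) v = 0.
  apply: hz; apply/colP => i; have /colP/(_ i) := hv; rewrite !mxE => /(congr1 (@Im R)) /=.
  rewrite (raddf_sum (@Im R)) => h; rewrite -[RHS]h; apply: eq_bigr => j _.
  by rewrite !mxE; case: (v j 0) => ? ? /=; rewrite mul0r addr0.
apply/colP => i; move/colP/(_ i): r0; move/colP/(_ i): i0; rewrite !mxE.
by case: (v i 0) => a b /= -> ->.
Qed.

(** [K] is the companion matrix of the pencil made monic by [pencil2]. The transposes appear because
    [K] acts on rows, whereas the pencil acts on columns. *)
Let X : 'M[C]_m.+1 := - ((toC pencil0)^T *m invmx (toC pencil2)^T).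
Let Y : 'M[C]_m.+1 := - ((toC pencil1)^T *m invmx (toC pencil2)^T).
Let K : 'M[C]_(m.+1 + m.+1) := block_mx 0 X 1%:M Y.

Let Q2_unit : (toC pencil2)^T \in unitmx.
Proof. by rewrite unitmx_tr map_unitmx pencil2_unit. Qed.

Let XQ : X *m (toC pencil2)^T = - (toC pencil0)^T.
Proof. by rewrite /X mulNmx mulmxKV. Qed.

Let YQ : Y *m (toC pencil2)^T = - (toC pencil1)^T.
Proof. by rewrite /Y mulNmx mulmxKV. Qed.

(** Turns a generalized eigenvector of order at most 2 into the data of an exponential solution: [w]
    is the left half of [e] and [v] the left half of [e (K - t)]. The equations are the two block
    columns of [K], cleared of the inverse of [pencil2]. *)
Lemma pencil_chain (t : C) (e : 'rV[C]_(m.+1 + m.+1)) :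
  e *m (K - t%:M) *m (K - t%:M) = 0 ->
  exists f : 'cV[C]_m.+1,
    [/\ symbol A (pencil_pt t) *m f = 0,
        symbol A (pencil_pt t) *m (lsubmx e)^T + dsymbol A (pencil_pt t) *m f = 0 &
        (rsubmx e)^T = t *: (lsubmx e)^T + f].
Proof.
have KE (g : 'rV[C]_(m.+1 + m.+1)) :
    g *m K = row_mx (rsubmx g) (lsubmx g *m X + rsubmx g *m Y).
  by rewrite -[g in LHS]hsubmxK mul_row_block mulmx0 add0r mulmx1.
set g := e *m _; rewrite mulmxBr mul_mx_scalar => /eqP; rewrite subr_eq0 => /eqP gK.
have eK : e *m K = t *: e + g by rewrite /g mulmxBr mul_mx_scalar addrC subrK.
have g2 : rsubmx g = t *: lsubmx g.
  by have := congr1 lsubmx gK; rewrite KE row_mxKl linearZ.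
have g3 : lsubmx g *m X + rsubmx g *m Y = t *: rsubmx g.
  by have := congr1 rsubmx gK; rewrite KE row_mxKr linearZ.
have e2 : rsubmx e = t *: lsubmx e + lsubmx g.
  by have := congr1 lsubmx eK; rewrite KE row_mxKl linearD linearZ.
have e3 : lsubmx e *m X + rsubmx e *m Y = t *: rsubmx e + rsubmx g.
  by have := congr1 rsubmx eK; rewrite KE row_mxKr linearD linearZ.
move: g3 e3; rewrite e2 g2; move: (lsubmx g) (lsubmx e) => f v.
move=> /(congr1 (mulmx^~ (toC pencil2)^T)) h1 /(congr1 (mulmx^~ (toC pencil2)^T)) h2.
have hX (z : 'rV[C]_m.+1) : z *m X *m (toC pencil2)^T = - (z *m (toC pencil0)^T).
  by rewrite -mulmxA XQ mulmxN.
have hY (z : 'rV[C]_m.+1) : z *m Y *m (toC pencil2)^T = - (z *m (toC pencil1)^T).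
  by rewrite -mulmxA YQ mulmxN.
exists f^T; split.
- apply: trmx_inj; rewrite trmx_mul trmxK trmx0 symbol_pencil !linearD !linearZ /=.
  move: h1; rewrite mulmxDl hX hY -?scalemxAl ?mulmxDr -?scalemxAr.
  move: (f *m (toC pencil0)^T) (f *m (toC pencil1)^T) (f *m (toC pencil2)^T) => f0 f1 f2 h; apply/rowP => i.
  move/rowP/(_ i): h; rewrite !mxE => h.
  by rewrite -[RHS](subrr (t * (t * f2 0 i))) -{2}h; ring.
- apply: trmx_inj; rewrite linearD /= !trmx_mul !trmxK trmx0 symbol_pencil dsymbol_pencil.
  rewrite !linearD !linearZ /=.
  move: h2; rewrite mulmxDl hX hY !mulmxDl -?scalemxAl ?mulmxDr -?scalemxAr.
  rewrite mulmxDl -!scalemxAl.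
  move: (v *m (toC pencil0)^T) (v *m (toC pencil1)^T) (v *m (toC pencil2)^T)
    (f *m (toC pencil1)^T) (f *m (toC pencil2)^T) => v0 v1 v2 f1 f2 h.
  apply/rowP => i; move/rowP/(_ i): h; rewrite !mxE => h.
  rewrite -[RHS](subrr (t * (t * v2 0 i + f2 0 i) + t * f2 0 i)) -{2}h; ring.
- by rewrite linearD linearZ.
Qed.

Lemma symbolZ (c : C) zeta : symbol A (fun k => c * zeta k) = c ^+ 2 *: symbol A zeta.
Proof.
rewrite /symbol scaler_sumr; apply: eq_bigr => j _; rewrite scaler_sumr.
by apply: eq_bigr => k _; rewrite scalerA mulrACA expr2.
Qed.

Lemma dsymbolZ (c : C) zeta : dsymbol A (fun k => c * zeta k) = c *: dsymbol A zeta.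
Proof.
rewrite /dsymbol scaler_sumr; apply: eq_bigr => j _; rewrite scaler_sumr.
by apply: eq_bigr => k _; rewrite scalerA; congr (_ *: _); ring.
Qed.

Variable S : set 'cV[R]_m.+1.
Hypothesis S_body : convex_body S.
Hypothesis S_inv : invariant_set A (half_space R n) S.
Variable nu : 'I_m.+2 -> 'cV[R]_m.+1.
Hypothesis nu_normal : forall i, unit_normals S (nu i).
Hypothesis nu_gp : forall i0 (c : 'I_m.+2 -> R),
  c i0 = 0 -> \sum_i c i *: nu i = 0 -> forall i, c i = 0.

Lemma mulmx_cdot (e : 'rV[C]_m.+1) (z : 'cV[R]_m.+1) :
  e *m toC z = 0 <-> cdot e^T z = 0.
Proof.
have eE : (e *m toC z) 0 0 = cdot e^T z.
  by rewrite mxE; apply: eq_bigr => j _; rewrite !mxE.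
split=> [h|h]; first by rewrite -eE h mxE.
by apply/matrixP => p q; rewrite !ord1 eE h mxE.
Qed.

(* Eigenvalues in the lower half-plane are reduced to the upper one by the
   symmetry [zeta -> - zeta], i.e. [s = -1]. *)
Lemma pencil_key_sign (s : R) a b (e f : 'rV[C]_(m.+1 + m.+1)) i :
  s * s = 1 -> 0 < s * Im a -> 0 < s * Im b ->
  e *m (K - a%:M) *m (K - a%:M) = 0 -> f *m (K - b%:M) *m (K - b%:M) = 0 ->
  lsubmx (e + f) *m toC (nu i) = 0 -> rsubmx (e + f) *m toC (nu i) = 0.
Proof.
move=> ss sa sb /pencil_chain[v1 [hv1 hw1 r1]] /pencil_chain[v2 [hv2 hw2 r2]].
have scc : s%:C * s%:C = 1 by rewrite -rmorphM ss rmorph1.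
have pt_up c : 0 < s * Im c -> upper (fun k => s%:C * pencil_pt c k).
  move=> sc; split=> [k kn|]; rewrite /pencil_pt /=.
    by rewrite eq_sym (negbTE kn) mulr0 addr0 /=; ring.
  by rewrite eqxx mulr1 xi_last; case: c sc => ? ? /=; rewrite mul0r addr0 add0r.
have re12 k : k != ord_max ->
    Re (s%:C * pencil_pt a k) = Re (s%:C * pencil_pt b k).
  by move=> kn; rewrite /pencil_pt eq_sym (negbTE kn) !mulr0.
have sv c v : symbol A (pencil_pt c) *m v = 0 ->
    symbol A (fun k => s%:C * pencil_pt c k) *m (s%:C *: v) = 0.
  by move=> h; rewrite symbolZ expr2 scc scale1r -scalemxAr h scaler0.
have sw c w v : symbol A (pencil_pt c) *m w + dsymbol A (pencil_pt c) *m v = 0 ->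
    symbol A (fun k => s%:C * pencil_pt c k) *m w +
    dsymbol A (fun k => s%:C * pencil_pt c k) *m (s%:C *: v) = 0.
  move=> h; rewrite symbolZ dsymbolZ expr2 scc scale1r -scalemxAr -scalemxAl.
  by rewrite scalerA scc scale1r.
have last c : s%:C * pencil_pt c ord_max = s%:C * c.
  by rewrite /pencil_pt eqxx mulr1 xi_last add0r.
move=> /mulmx_cdot; rewrite !linearD /= => h0; apply/mulmx_cdot.
have := invariant_exp_vanish S_body S_inv (nu_normal i) (pt_up a sa) (pt_up b sb)
  re12 (sv _ a v1 hv1) (sw _ a _ v1 hw1) (sv _ b v2 hv2) (sw _ b _ v2 hw2) h0.
rewrite !last -!scalerA -!scalerDr -r1 -r2 cdotZl.
move/(congr1 (fun z => s%:C * z)); rewrite mulrA scc mul1r mulr0 => h.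
by rewrite linearD.
Qed.

(** By ellipticity the pencil is injective at real [t], so both vectors of the chain vanish. *)
Lemma pencil_real_eigen a (e : 'rV[C]_(m.+1 + m.+1)) :
  Im a = 0 -> e *m (K - a%:M) *m (K - a%:M) = 0 -> e = 0.
Proof.
move=> a0 /pencil_chain[f [hf hw r]].
have f0 := symbol_real_inj a0 hf.
move: hw; rewrite f0 mulmx0 addr0 => /(symbol_real_inj a0) l0.
move: r; rewrite f0 l0 scaler0 addr0 => r0.
rewrite -[e]hsubmxK -[lsubmx e]trmxK -[rsubmx e]trmxK l0 r0.
by rewrite !trmx0 row_mx0.
Qed.

Lemma pencil_key a b (e f : 'rV[C]_(m.+1 + m.+1)) i :
  (0 < Im a) = (0 < Im b) ->
  e *m (K - a%:M) *m (K - a%:M) = 0 -> f *m (K - b%:M) *m (K - b%:M) = 0 ->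
  lsubmx (e + f) *m toC (nu i) = 0 -> rsubmx (e + f) *m toC (nu i) = 0.
Proof.
have [a0|a0] := ltP 0 (Im a) => /esym b0 ea fb.
  by apply: (@pencil_key_sign 1 a b) => //; rewrite ?mul1r.
(* The case [Im c <= 0] includes real [c]; then [g = 0], and the eigenvalue may be replaced by
   [- i]. *)
have low c (g : 'rV[C]_(m.+1 + m.+1)) : Im c <= 0 ->
    g *m (K - c%:M) *m (K - c%:M) = 0 ->
    exists2 c', 0 < -1 * Im c' & g *m (K - c'%:M) *m (K - c'%:M) = 0.
  move=> c0 gc; have [cz|cn] := eqVneq (Im c) 0.
    exists (- 'i%C); first by rewrite /= mulN1r opprK.
    by rewrite (pencil_real_eigen cz gc) !mul0mx.
  by exists c => //; rewrite mulN1r oppr_gt0 lt_neqAle cn.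
have [a' a'0 ea'] := low _ _ a0 ea.
have [|b' b'0 fb'] := low b _ _ fb; first by rewrite leNgt b0.
by apply: (@pencil_key_sign (-1) a' b') => //; rewrite mulrNN mulr1.
Qed.

(** [common_eigenvalue], with [up] the upper half-plane, yields [a = al + i be] with [be > 0] at
    which the whole pencil vanishes. Its imaginary part gives [pencil1 = - 2 al pencil2], and then
    its real part gives [pencil0 = (al^2 + be^2) pencil2]. *)
Lemma pencil_scalar : exists p0 p1 : R,
  pencil0 = p0 *: pencil2 /\ pencil1 = p1 *: pencil2.
Proof.
(* General position passes from real to complex coefficients by taking real and imaginary parts. *)
have gp i0 (c : 'I_m.+2 -> C) : c i0 = 0 -> \sum_i c i *: toC (nu i) = 0 ->
    forall i, c i = 0.
  move=> c0 sum0 i.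
  have re0 : \sum_i Re (c i) *: nu i = 0.
    apply/colP => l; move/colP/(_ l): sum0; rewrite !summxE mxE.
    move/(congr1 (@Re R)); rewrite (raddf_sum (@Re R)) mxE => h.
    rewrite -[RHS]h; apply: eq_bigr => j _; rewrite !mxE.
    by case: (c j) => ? ? /=; rewrite mulr0 subr0.
  have im0 : \sum_i Im (c i) *: nu i = 0.
    apply/colP => l; move/colP/(_ l): sum0; rewrite !summxE mxE.
    move/(congr1 (@Im R)); rewrite (raddf_sum (@Im R)) mxE => h.
    rewrite -[RHS]h; apply: eq_bigr => j _; rewrite !mxE.
    by case: (c j) => ? ? /=; rewrite mulr0 add0r.
  have := nu_gp (c := fun i => Re (c i)) (congr1 (@Re R) c0) re0 i.
  have := nu_gp (c := fun i => Im (c i)) (congr1 (@Im R) c0) im0 i.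
  by case: (c i) => ? ? /= -> ->.
have [a a0 ha] := @common_eigenvalue _ m X Y (fun a => 0 < Im a)
  (fun i => toC (nu i)) gp pencil_key.
have hP : a ^+ 2 *: (toC pencil2)^T + (toC pencil0)^T + a *: (toC pencil1)^T = 0.
  apply/row_matrixP => i; rewrite row0 !rowE.
  have := congr1 (mulmx^~ (toC pencil2)^T) (ha (delta_mx 0 i)).
  rewrite mulmxDl -!scalemxAl -mulmxA XQ -(mulmxA _ Y) YQ !mulmxN scalerN.
  move=> h; rewrite !mulmxDr -!scalemxAr h.
  by rewrite addrAC subrK addNr.
case: a a0 ha hP => al be /= b0 _ hP.
have ent i j : (al ^+ 2 - be ^+ 2) * pencil2 i j + pencil0 i j + al * pencil1 i j = 0
    /\ 2 * al * be * pencil2 i j + be * pencil1 i j = 0.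
  move/matrixP/(_ j i): hP; rewrite !mxE expr2.
  move=> h; have h1 := congr1 (@Re R) h; have h2 := congr1 (@Im R) h.
  move: h1 h2 => /= h1 h2; split.
    by rewrite -[RHS]h1; ring.
  by rewrite -[RHS]h2; ring.
have p1E : pencil1 = (- 2 * al) *: pencil2.
  apply/matrixP => i j; rewrite mxE; have [_ h] := ent i j.
  apply: (mulfI (lt0r_neq0 b0)).
  by move: h => /eqP; rewrite addrC addr_eq0 => /eqP ->; ring.
exists (al ^+ 2 + be ^+ 2), (- 2 * al); split => //.
apply/matrixP => i j; rewrite mxE; have [h _] := ent i j.
by move: h; rewrite p1E mxE => h; apply/eqP; rewrite -subr_eq0 -[X in _ == X]h; apply/eqP; ring.
Qed.

End Pencil.

(** * Polarization and proportionality of the coefficients *)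

Lemma sum_delta2 (R : pzRingType) (V : lmodType R) (n : nat)
    (F : 'I_n -> 'I_n -> V) p q :
  \sum_j \sum_k ((j == p)%:R * (k == q)%:R) *: F j k = F p q.
Proof.
rewrite (bigD1 p) //= (bigD1 q) //= !eqxx mulr1 scale1r.
rewrite big1 ?addr0 => [|k /negbTE ->]; last by rewrite mulr0 scale0r.
rewrite big1 ?addr0 // => j /negbTE ->; rewrite big1 // => k _.
by rewrite mul0r scale0r.
Qed.

(** The quadratic form at [e_p + e_q], from which polarization recovers the mixed coefficients. *)
Lemma sum_delta2D (R : pzRingType) (V : lmodType R) (n : nat)
    (F : 'I_n -> 'I_n -> V) p q :
  \sum_j \sum_k (((j == p)%:R + (j == q)%:R) * ((k == p)%:R + (k == q)%:R)) *: F j k =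
  (F p p + F p q) + (F q p + F q q).
Proof.
rewrite -!(sum_delta2 F) -!big_split; apply: eq_bigr => j _ /=.
rewrite -!big_split; apply: eq_bigr => k _ /=; rewrite -!scalerDl.
by rewrite -!mulrDr -mulrDl.
Qed.

Section Necessity.
Variables (R : realType) (n m : nat).
Variable A : 'I_n.+1 -> 'I_n.+1 -> 'M[R]_m.+1.
Hypothesis A_sym : forall j k, A j k = A k j.
Hypothesis A_elliptic : strongly_elliptic A.
Variable S : set 'cV[R]_m.+1.
Hypothesis S_body : convex_body S.
Hypothesis S_inv : invariant_set A (half_space R n) S.
Variable nu : 'I_m.+2 -> 'cV[R]_m.+1.
Hypothesis nu_normal : forall i, unit_normals S (nu i).
Hypothesis nu_free : forall I : {set 'I_m.+2}, #|I| = m.+1 -> free [seq nu i | i in I].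

(** A relation missing [nu i0] lives on the complement of [i0], a set of [m.+1] indices, on which
    the family is free. *)
Lemma general_position_free i0 (c : 'I_m.+2 -> R) :
  c i0 = 0 -> \sum_i c i *: nu i = 0 -> forall i, c i = 0.
Proof.
move=> c0 sum0; pose I := [set~ i0]%SET.
have cardI : #|I| = m.+1 by rewrite cardsC1 card_ord.
have := nu_free cardI; set s := [seq nu i | i in I].
rewrite -[s]/(tval (in_tuple s)) => /freeP fr i.
have [->//|ii0] := eqVneq i i0.
have iI : i \in enum I by rewrite mem_enum !inE.
have sz : size s = size (enum I) by rewrite size_map.
pose k (j : 'I_(size s)) := c (nth i0 (enum I) j).
have ji : (index i (enum I) < size s)%N by rewrite sz index_mem.
have := fr k _ (Ordinal ji); rewrite /k /= nth_index //; apply.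
rewrite -[RHS]sum0 [RHS](bigID (mem I)) /= [X in _ = _ + X]big1 ?addr0; last first.
  by move=> j; rewrite !inE negbK => /eqP ->; rewrite c0 scale0r.
rewrite -[RHS]big_enum [RHS](big_nth i0) big_mkord -sz; apply: eq_bigr => j _.
by rewrite (nth_map i0) // -sz.
Qed.

Let N : 'I_n.+1 := ord_max.

(** The pencil at [xi = e_p] settles [A p p] and, by symmetry, [A p N]; the one at [xi = e_j + e_k]
    settles [A j k] after subtracting the diagonal terms. *)
Lemma coefficients_proportional j k : exists c, A j k = c *: A N N.
Proof.
have gp := general_position_free.
have scal (xi : 'I_n.+1 -> R) (x0 : xi ord_max = 0) (xn : exists k, xi k != 0) :=
  pencil_scalar A_elliptic x0 xn S_body S_inv nu_normal gp.
have single p : p != N ->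
    (exists c, A p p = c *: A N N) /\ (exists c, A p N = c *: A N N).
  move=> pN; pose xi q : R := (q == p)%:R.
  have x0 : xi ord_max = 0 by rewrite /xi eq_sym (negbTE pN).
  have xn : exists q, xi q != 0 by exists p; rewrite /xi eqxx oner_eq0.
  have [p0 [p1 []]] := scal xi x0 xn.
  rewrite /pencil0 sum_delta2 /pencil1 => h0 h1; split; first by exists p0.
  exists (p1 / 2).
  have : A p N + A N p = p1 *: A N N.
    rewrite -[RHS]h1 -!(sum_delta2 A) -big_split; apply: eq_bigr => j' _ /=.
    rewrite -big_split; apply: eq_bigr => k' _ /=; rewrite -scalerDl.
    by rewrite /xi (eq_sym _ j') (eq_sym _ k').
  rewrite (A_sym N p) -mulr2n -scaler_nat => /(congr1 ( *:%R 2^-1)).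
  by rewrite !scalerA mulVf ?pnatr_eq0 // scale1r mulrC.
have [->|jN] := eqVneq j N.
  have [->|kN] := eqVneq k N; first by exists 1; rewrite scale1r.
  by have [_ [c h]] := single k kN; exists c; rewrite A_sym.
have [[cj hj] jn] := single j jN.
have [->//|kN] := eqVneq k N.
have [->|jk] := eqVneq j k; first by have [[c h] _] := single k kN; exists c.
have [[ck hk] _] := single k kN.
pose xi q : R := (q == j)%:R + (q == k)%:R.
have x0 : xi ord_max = 0.
  by rewrite /xi (eq_sym ord_max) (negbTE jN) (eq_sym ord_max) (negbTE kN) addr0.
have xn : exists q, xi q != 0.
  by exists j; rewrite /xi eqxx (negbTE jk) addr0 oner_eq0.
have [p0 [p1 [h0 _]]] := scal xi x0 xn.
have : (A j j + A j k) + (A k j + A k k) = p0 *: A N N.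
  by rewrite -[RHS]h0 -sum_delta2D.
rewrite hj hk (A_sym k j) => h; exists ((p0 - cj - ck) / 2).
have {}h : A j k + A j k = (p0 - cj - ck) *: A N N.
  apply/matrixP => p q; move/matrixP/(_ p q): h; rewrite !mxE => h.
  by rewrite !mulrBl -h; ring.
rewrite -[LHS](scalerK (_ : (2 : R) != 0)) ?pnatr_eq0 //.
by rewrite scaler_nat (mulr2n (A j k)) h scalerA mulrC.
Qed.

Lemma necessity : exists (a : 'I_n.+1 -> 'I_n.+1 -> R) (A0 : 'M[R]_m.+1),
  [/\ scalar_elliptic a, A0 \in unitmx,
      strongly_elliptic (fun j k => a j k *: A0)
    & forall u : 'cV[R]_n.+1 -> 'cV[R]_m.+1, C2_on setT u ->
        forall x, system_op A u x = A0 *m scalar_op a u x].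
Proof.
have [a ha] : exists a : 'I_n.+1 -> 'I_n.+1 -> R, forall j k, A j k = a j k *: A N N.
  have h1 j : exists c : 'I_n.+1 -> R, forall k, A j k = c k *: A N N.
    by have [c hc] := choice (coefficients_proportional j); exists c.
  by have [a ha] := choice h1; exists a.
exists a, (A N N).
have AE : A = (fun j k => a j k *: A N N) by apply/funext => j; apply/funext => k.
split.
- move=> s s0; apply/eqP => as0.
  (* If the scalar form vanishes at [s], so does the whole symbol, and the nonzero vector of ones
     lies in its kernel. *)
  have one0 : (const_mx 1 : 'cV[R]_m.+1) = 0.
    apply: (strongly_elliptic_inj A_elliptic (s := fun k => s k 0)).
      apply: contrapT => h; move/eqP: s0; apply; apply/colP => k; rewrite mxE.
      by apply: contrapT => /eqP sk; apply: h; exists k.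
    rewrite (_ : \sum_j _ = 0) ?mul0mx // -[RHS](scale0r (A N N)) -[X in _ = X *: _]as0.
    rewrite scaler_suml; apply: eq_bigr => j _; rewrite scaler_suml.
    by apply: eq_bigr => k _; rewrite [in LHS]ha scalerA; congr (_ *: _); ring.
  by move/colP/(_ 0): one0; rewrite !mxE => /eqP; rewrite oner_eq0.
- exact: pencil2_unit.
- by rewrite -AE.
- move=> u _ x; rewrite /system_op /scalar_op mulmx_sumr; apply: eq_bigr => j _.
  rewrite mulmx_sumr; apply: eq_bigr => k _.
  by rewrite [in LHS]ha -scalemxAl -scalemxAr.
Qed.

End Necessity.

(** * The maximum principle in a half-space *)

Section DirectionalDerivative.
Variables (R : realType).

Lemma is_derive_shift_line (V W : normedModType R) (f : V -> W) (v y : V) (t : R)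
    (df : W) :
  is_derive (t *: v + y) v f df -> is_derive t (1 : R) (fun s : R => f (s *: v + y)) df.
Proof.
move=> h; have E : (fun s : R => s^-1 *: (f ((s *: (1 : R) + t) *: v + y) - f (t *: v + y))) =
  (fun s : R => s^-1 *: (f (s *: v + (t *: v + y)) - f (t *: v + y))).
  by apply/funext => s; rewrite [_%:A]mulr1 scalerDl addrA.
apply: DeriveDef.
  have := @ex_derive _ _ _ _ _ _ _ h; rewrite /derivable => d.
  by rewrite /derivable E.
by rewrite -[RHS](@derive_val _ _ _ _ _ _ _ h) /derive E.
Qed.

Lemma is_derive_mean_value (V : normedModType R) (f g : V -> R) (v y : V) (s : R) :
  (forall t, `|t| <= `|s| -> is_derive (t *: v + y) v f (g (t *: v + y))) ->
  exists2 t, `|t| <= `|s| & f (s *: v + y) - f y = s * g (t *: v + y).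
Proof.
move=> h; pose phi (t : R) := f (t *: v + y).
have dphi (t : R) : `|t| <= `|s| -> is_derive t (1 : R) phi (g (t *: v + y)).
  by move=> ts; apply: is_derive_shift_line; exact: h.
have phi0 : phi 0 = f y by rewrite /phi scale0r add0r.
have cont (a b : R) : (forall t : R, a <= t <= b -> `|t| <= `|s|) ->
    {within `[a, b], continuous phi}.
  move=> ab; apply: derivable_within_continuous => t.
  rewrite in_itv /= => /ab /dphi hd; exact: (@ex_derive _ _ _ _ _ _ _ hd).
have [s0|s0] := leP 0 s.
  have b01 (t : R) : 0 <= t <= s -> `|t| <= `|s|.
    by move=> /andP[t0 ts]; rewrite !ger0_norm // (le_trans t0).
  have [|t] := @MVT_segment _ phi (fun t => g (t *: v + y)) 0 s s0 _ (cont 0 s b01).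
    by move=> t; rewrite in_itv /= => /andP[t0 ts]; apply: dphi; rewrite b01 ?ltW.
  rewrite in_itv /= => /b01 ts; rewrite phi0 subr0 mulrC => E.
  by exists t.
have b01 (t : R) : s <= t <= 0 -> `|t| <= `|s|.
  by move=> /andP[t0 ts]; rewrite ler0_norm // ltr0_norm // lerN2.
have [|t] := @MVT_segment _ phi (fun t => g (t *: v + y)) s 0 (ltW s0) _ (cont s 0 b01).
  by move=> t; rewrite in_itv /= => /andP[t0 ts]; apply: dphi; rewrite b01 ?ltW.
rewrite in_itv /= => /b01 ts; rewrite phi0 sub0r => E.
by exists t => //; rewrite -opprB E mulrN opprK mulrC.
Qed.

(** The increment along [h (z + c v)] is split into [h z] followed by [h c v]; the mean value
    theorem and the continuity of [g] at [x] handle the second piece. *)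
Lemma is_derive_add_direction (V : normedModType R) (f g : V -> R) (x z v : V)
    (c d : R) :
  is_derive x z f d -> (\forall y \near x, is_derive y v f (g y)) ->
  {for x, continuous g} -> is_derive x (z + c *: v) f (d + c * g x).
Proof.
move=> hz hv cg.
have cz : h^-1 *: (f (h *: z + x) - f x) @[h --> (0 : R)^'] --> d.
  by rewrite -[d](@derive_val _ _ _ _ _ _ _ hz); exact: (@ex_derive _ _ _ _ _ _ _ hz).
have cE : h^-1 *: (f (h *: (z + c *: v) + x) - f (h *: z + x)) @[h --> (0 : R)^']
    --> c * g x.
  apply/cvgrPdist_le => e e0.
  pose e' := e / (`|c| + 1).
  have c1 : 0 < `|c| + 1 by rewrite ltr_wpDl.
  have e'0 : 0 < e' by rewrite divr_gt0.
  have : \forall y \near x, is_derive y v f (g y) /\ `|g x - g y| <= e'.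
    near=> y; split; first by near: y.
    by near: y; move/cvgrPdist_le: cg; apply.
  move=> /nbhs_ballP[r /= r0 hr].
  pose L := `|z| + `|c| * `|v| + 1.
  have L0 : 0 < L by rewrite ltr_wpDl // addr_ge0 // mulr_ge0.
  near=> h.
  have h0 : h != 0 by near: h; exact: nbhs_dnbhs_neq.
  have hL : `|h| < r / L by near: h; apply: dnbhs0_lt; rewrite divr_gt0.
  have inb (t : R) : `|t| <= `|h * c| -> ball x r (t *: v + (h *: z + x)).
    move=> th; rewrite -ball_normE /= addrA opprD addrCA subrr addr0 normrN.
    apply: le_lt_trans (ler_normD _ _) _; rewrite !normrZ.
    apply: le_lt_trans (_ : `|h| * (`|z| + `|c| * `|v|) < _).
      rewrite mulrDr addrC lerD2l mulrA -normrM; exact: ler_wpM2r.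
    apply: le_lt_trans (_ : `|h| * L < _).
      by rewrite ler_wpM2l // lerDl.
    by rewrite -ltr_pdivlMr.
  have [t th ->] : exists2 t, `|t| <= `|h * c| &
      f (h *: (z + c *: v) + x) - f (h *: z + x) = (h * c) * g (t *: v + (h *: z + x)).
    have -> : h *: (z + c *: v) + x = (h * c) *: v + (h *: z + x).
      by rewrite scalerDr scalerA addrA (addrC (h *: z)).
    by apply: is_derive_mean_value => t th; have [] := hr _ (inb t th).
  rewrite [_ *: _]mulrA mulrA mulVf // mul1r -mulrBr normrM.
  have [_ ge] := hr _ (inb t th).
  apply: le_trans (_ : `|c| * e' <= _); first by rewrite ler_wpM2l.
  rewrite /e' mulrCA ger_pMr // ler_pdivrMr // mul1r; lra.
have cS : h^-1 *: (f (h *: (z + c *: v) + x) - f x) @[h --> (0 : R)^']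
    --> d + c * g x.
  have -> : (fun h : R => h^-1 *: (f (h *: (z + c *: v) + x) - f x)) =
    (fun h => h^-1 *: (f (h *: z + x) - f x) +
      h^-1 *: (f (h *: (z + c *: v) + x) - f (h *: z + x))).
    by apply/funext => h; rewrite -scalerDr (addrC (f (h *: z + x) - f x)) subrKA.
  exact: (@cvgD _ _ _ _ _ _ _ _ _ cz cE).
apply: DeriveDef; first by apply/cvg_ex; exists (d + c * g x).
exact: cvg_lim cS.
Unshelve. all: by end_near. Qed.

(** Continuous partial derivatives give all directional ones: the coordinate directions are added
    one at a time, starting from the zero direction. *)
Lemma is_derive_C1 (N m : nat) (D : set 'cV[R]_N) (f : 'cV[R]_N -> 'cV[R]_m)
    (x q : 'cV[R]_N) :
  open D -> D x ->
  (forall k y, D y -> derivable f y (delta_mx k 0) /\ {for y, continuous (pd k f)}) ->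
  is_derive x q f (\sum_k q k 0 *: pd k f x).
Proof.
move=> oD Dx hf.
have comp i : is_derive x q (fun y => f y i 0) (\sum_k q k 0 * pd k f x i 0).
  have qE : q = \sum_k q k 0 *: (delta_mx k 0 : 'cV[R]_N).
    apply/colP => j; rewrite summxE (bigD1 j) //= !mxE !eqxx mulr1 big1 ?addr0 //.
    by move=> k kj; rewrite !mxE eq_sym (negbTE kj) mulr0.
  rewrite [X in is_derive _ X](qE); elim: (index_enum _) => [|k s IH].
    by rewrite !big_nil; exact: is_derive0.
  rewrite !big_cons addrC [X in is_derive _ _ _ X]addrC.
  apply: (@is_derive_add_direction _ _ (fun y => pd k f y i 0) _ _ _ _ _ IH).
    near=> y; have Dy : D y by near: y; exact: open_nbhs_nbhs.
    have [d _] := hf k y Dy; apply: DeriveDef.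
      by move/derivable_mxP: d => /(_ i 0).
    by rewrite /pd derive_mx // mxE.
  have [_ c] := hf k x Dx.
  exact: (cvg_comp _ _ c (@coord_continuous R m 1 i 0 _)).
have d : derivable f x q.
  apply/derivable_mxP => i j; rewrite (ord1 j); exact: (@ex_derive _ _ _ _ _ _ _ (comp i)).
apply: (DeriveDef d); rewrite derive_mx //; apply/colP => i; rewrite mxE.
rewrite (@derive_val _ _ _ _ _ _ _ (comp i)) summxE.
by apply: eq_bigr => k _; rewrite !mxE.
Unshelve. all: by end_near. Qed.

Lemma is_derive_dotv (V : normedModType R) (m : nat) (f : V -> 'cV[R]_m) (x v : V)
    (df mu : 'cV[R]_m) :
  is_derive x v f df -> is_derive x v (fun y => dotv (f y) mu) (dotv df mu).
Proof.
move=> h; have c : s^-1 *: (f (s *: v + x) - f x) @[s --> (0 : R)^'] --> df.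
  by rewrite -[df](@derive_val _ _ _ _ _ _ _ h); exact: (@ex_derive _ _ _ _ _ _ _ h).
have c2 : s^-1 *: (dotv (f (s *: v + x)) mu - dotv (f x) mu) @[s --> (0 : R)^']
    --> dotv df mu.
  have -> : (fun s : R => s^-1 *: (dotv (f (s *: v + x)) mu - dotv (f x) mu)) =
    (fun s => dotv (s^-1 *: (f (s *: v + x) - f x)) mu).
    by apply/funext => s; rewrite dotvZl dotvBl.
  exact: (cvg_comp _ _ c (@dotv_continuous R m mu df)).
apply: DeriveDef; first by apply/cvg_ex; exists (dotv df mu).
exact: cvg_lim c2.
Qed.

(** At the maximum [g1 0 = 0]. If [c > 0], then [g1] is positive just to the right of 0, and by the
    mean value theorem [g] exceeds [g 0] there. *)
Lemma second_derivative_at_max (g g1 : R -> R) (c r : R) : 0 < r ->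
  (forall t, `|t| < r -> is_derive (t : R) (1 : R) g (g1 t)) ->
  is_derive (0 : R) (1 : R) g1 c ->
  (forall t, `|t| < r -> g t <= g 0) -> c <= 0.
Proof.
move=> r0 dg dg1 gmax.
have in_r t : (- r < t < r) = (`|t| < r) by rewrite ltr_norml.
have g10 : g1 0 = 0.
  have h : is_derive (0 : R) (1 : R) g 0.
    apply: (@derive1_at_max R g (- r) r 0); first lra.
    - by move=> t; rewrite in_itv /= in_r => /dg hd; exact: (@ex_derive _ _ _ _ _ _ _ hd).
    - by rewrite in_itv /= in_r normr0.
    - by move=> t; rewrite in_itv /= in_r; exact: gmax.
  have h2 := dg 0; rewrite normr0 in h2.
  by rewrite -(@derive_val _ _ _ _ _ _ _ (h2 r0)) (@derive_val _ _ _ _ _ _ _ h).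
rewrite leNgt; apply/negP => c0.
have cv : h^-1 *: (g1 (h *: 1 + 0) - g1 0) @[h --> (0 : R)^'] --> c.
  by rewrite -[c](@derive_val _ _ _ _ _ _ _ dg1); exact: (@ex_derive _ _ _ _ _ _ _ dg1).
have : \forall h \near (0 : R)^', 0 < h^-1 *: (g1 (h *: 1 + 0) - g1 0).
  exact: (cvgr_gt _ cv).
rewrite /dnbhs /within => /nbhs_ballP[s /= s0 hs].
have pos t : 0 < t -> t < s -> 0 < g1 t.
  move=> t0 ts; have := hs t; rewrite -ball_normE /= sub0r normrN gtr0_norm // => /(_ ts).
  rewrite gt_eqF // => /(_ isT); rewrite g10 subr0 addr0 [t *: _]mulr1.
  by rewrite [_ *: _](_ : _ = t^-1 * g1 t) // pmulr_rgt0 // invr_gt0.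
pose t := Num.min r s / 2.
have m0 : 0 < Num.min r s by rewrite lt_min r0 s0.
have mr : Num.min r s <= r by rewrite ge_min lexx.
have ms : Num.min r s <= s by rewrite ge_min lexx orbT.
have t0 : 0 < t by rewrite divr_gt0.
have tr : t < r by rewrite /t; lra.
have ts : t < s by rewrite /t; lra.
have [||z] := @MVT _ g g1 0 t t0.
- move=> z; rewrite in_itv /= => /andP[z0 zt]; apply: dg.
  by rewrite gtr0_norm // (lt_trans zt).
- apply: derivable_within_continuous => z; rewrite in_itv /= => /andP[z0 zt].
  have hd := dg z; rewrite ger0_norm // in hd.
  exact: (@ex_derive _ _ _ _ _ _ _ (hd (le_lt_trans zt tr))).
rewrite in_itv /= subr0 => /andP[z0 zt] E.
have := gmax t; rewrite gtr0_norm // => /(_ tr).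
have : 0 < g1 z * t by rewrite mulr_gt0 // pos // (lt_trans zt).
lra.
Qed.

End DirectionalDerivative.

(** Cholesky factorization by induction on the size: with [B] in blocks [p, c^T, c, D], the Schur
    complement [D' = D - c c^T / p] is again symmetric and positive definite. *)
Lemma pos_def_gram (R : realType) (N : nat) (B : 'M[R]_N) :
  B^T = B -> (forall x : 'cV[R]_N, x != 0 -> 0 < dotv (B *m x) x) ->
  exists Q : 'M[R]_N, B = Q *m Q^T.
Proof.
elim: N B => [|N IH] B; first by exists 0; rewrite flatmx0 [RHS]flatmx0.
rewrite -[N.+1]/(1 + N)%N in B * => B_sym B_pos.
have dot_col (a c : 'cV[R]_1) (b d : 'cV[R]_N) :
    dotv (col_mx a b) (col_mx c d) = dotv a c + dotv b d.
  rewrite /dotv big_split_ord; congr (_ + _); apply: eq_bigr => i _.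
    by rewrite !col_mxEu.
  by rewrite !col_mxEd.
pose p := ulsubmx B 0 0; pose c := dlsubmx B; pose D := drsubmx B.
have BE : B = block_mx p%:M c^T c D.
  rewrite -[LHS]submxK -mx11_scalar; congr (block_mx _ _ _ _).
  by rewrite /c -[in RHS]B_sym trmx_dlsub trmxK.
have D_sym : D^T = D by rewrite /D trmx_drsub B_sym.
clearbody p c D.
have p0 : 0 < p.
  have e0 : col_mx (1%:M : 'cV[R]_1) (0 : 'cV[R]_N) != 0.
    by rewrite col_mx_eq0 oner_eq0.
  have := B_pos _ e0; rewrite BE mul_block_col !mulmx0 !addr0 !mulmx1 dot_col.
  by rewrite [dotv c 0]dotvC dotv0l addr0 /dotv big_ord1 !mxE eqxx !mulr1n mulr1.
pose D' := D - p^-1 *: (c *m c^T).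
have D'_sym : D'^T = D' by rewrite linearB linearZ /= trmx_mul trmxK D_sym.
have [|Q' hQ'] := IH D' D'_sym.
  (* For this [x], [B x] is [(0, D' y)], so the form of [B] at [x] is the form of [D'] at [y]. *)
  move=> y y0; pose x := col_mx (- p^-1 *: (c^T *m y)) y.
  have x0 : x != 0 by rewrite col_mx_eq0 (negbTE y0) andbF.
  have := B_pos x x0; rewrite BE mul_block_col.
  have -> : p%:M *m (- p^-1 *: (c^T *m y)) + c^T *m y = 0.
    by rewrite mul_scalar_mx scalerA mulrN mulfV ?gt_eqF // scaleN1r addNr.
  have -> : c *m (- p^-1 *: (c^T *m y)) + D *m y = D' *m y.
    by rewrite /D' mulmxBl -scalemxAr -scalemxAl mulmxA scaleNr addrC.
  by rewrite dot_col dotv0l add0r.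
pose s := Num.sqrt p.
have s0 : s != 0 by rewrite sqrtr_eq0 -ltNge.
have ss : s * s = p by rewrite -expr2 sqr_sqrtr // ltW.
exists (block_mx s%:M 0 (s^-1 *: c) Q').
rewrite tr_block_mx trmx0 mulmx_block !mulmx0 !mul0mx !addr0 tr_scalar_mx.
rewrite BE -scalar_mxM ss linearZ /= mul_scalar_mx scalerA mulfV // scale1r.
rewrite mul_mx_scalar scalerA mulfV // scale1r; congr (block_mx _ _ _ _).
rewrite -hQ' -scalemxAl -scalemxAr scalerA -invfM ss /D' addrC subrK //.
Qed.

Lemma is_derive_quadratic (R : realType) (a b c t : R) :
  is_derive (t : R) (1 : R) (fun s => a + b * s + c * (s * s)) (b + 2 * c * t).
Proof.
have := is_derive_poly (a%:P + b *: 'X + c *: 'X^2) t.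
have -> : horner (a%:P + b *: 'X + c *: 'X^2) = (fun s => a + b * s + c * (s * s)).
  by apply/funext => s; rewrite !hornerE; ring.
have -> : (a%:P + b *: 'X + c *: 'X^2)^`().[t] = b + 2 * c * t; last by [].
by rewrite !derivD derivC !derivZ derivX derivXn !hornerE; ring.
Qed.

(** * Barrier and exclusion of interior maxima *)

Section MaximumPrinciple.
Variables (R : realType) (n m : nat).
Variables (B : 'M[R]_n.+1).
Hypothesis B_sym : B^T = B.
Hypothesis B_pos : forall x : 'cV[R]_n.+1, x != 0 -> 0 < dotv (B *m x) x.
Variable u : 'cV[R]_n.+1 -> 'cV[R]_m.
Hypothesis u_C2 : C2_on (half_space R n) u.
Hypothesis u_pde : forall x, half_space R n x ->
  \sum_j \sum_k B j k *: pd j (pd k u) x = 0.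
Variables q0 mu : 'cV[R]_m.

Let N : 'I_n.+1 := ord_max.

(** For [k >= 0] and [0 <= x_n <= r] it is nonnegative, and at least 1 once some coordinate has
    absolute value [r]. The operator with matrix [B] takes it to the constant
    [2 (tr B - k B_nn) / r^2]. *)
Definition barrier (k r : R) (x : 'cV[R]_n.+1) : R :=
  dotv x x / r ^+ 2 + k * (x N 0 / r - x N 0 ^+ 2 / r ^+ 2).

Lemma barrier_line k r x q t : barrier k r (t *: q + x) =
  barrier k r x + (2 * dotv x q / r ^+ 2 + k * (q N 0 / r - 2 * x N 0 * q N 0 / r ^+ 2)) * t
  + (dotv q q - k * q N 0 ^+ 2) / r ^+ 2 * (t * t).
Proof.
rewrite /barrier !mxE !(dotvDl, dotvDr, dotvZl, dotvZr) (dotvC q x); ring.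
Qed.

(* At an interior maximum the second derivatives along the columns of [Q], where
   [B = Q Q^T], add up to [2 M / r^2 > 0]. *)
Lemma no_interior_max (M k r : R) (O : set 'cV[R]_n.+1) (xs : 'cV[R]_n.+1) :
  0 < M -> 0 < r -> \tr B - k * B N N = -1 ->
  open O -> O `<=` half_space R n -> O xs ->
  (forall y, O y -> dotv (u y - q0) mu - M * barrier k r y <=
                    dotv (u xs - q0) mu - M * barrier k r xs) -> False.
Proof.
move=> M0 r0 hk oO Oh Oxs xs_max.
have [Q hQ] := pos_def_gram B_sym B_pos.
have [u0 u1 u2] := u_C2.
have oh := @open_half_space R n.
have [rho /= rho0 hrho] : nbhs_ball xs O by apply/nbhs_ballP; exact: open_nbhs_nbhs.
(* The second derivative at the maximum [t = 0] along [xs + t q]; [barrier_line] makes the barrier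
   an explicit quadratic in [t]. *)
have line (q : 'cV[R]_n.+1) :
    dotv (\sum_i q i 0 *: \sum_j q j 0 *: pd j (pd i u) xs) mu -
    M * (2 * ((dotv q q - k * q N 0 ^+ 2) / r ^+ 2)) <= 0.
  set V := \sum_i _; set v2 := _ / _.
  pose v1 := 2 * dotv xs q / r ^+ 2 + k * (q N 0 / r - 2 * xs N 0 * q N 0 / r ^+ 2).
  pose b0 := barrier k r xs.
  pose G1 t := \sum_i q i 0 *: pd i u (t *: q + xs).
  pose g t := dotv (u (t *: q + xs)) mu +
    (- dotv q0 mu - M * b0 + (- M * v1) * t + (- M * v2) * (t * t)).
  pose g1 t := dotv (G1 t) mu + (- M * v1 + 2 * (- M * v2) * t).
  have gE t : g t = dotv (u (t *: q + xs) - q0) mu - M * barrier k r (t *: q + xs).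
    rewrite /g barrier_line dotvBl -/b0 -/v1 -/v2; ring.
  pose r1 := rho / (`|q| + 1).
  have q1 : 0 < `|q| + 1 by rewrite ltr_wpDl.
  have inO t : `|t| < r1 -> O (t *: q + xs).
    move=> tr; apply: hrho; rewrite -ball_normE /= opprD addrCA subrr addr0 normrN normrZ.
    apply: le_lt_trans (_ : `|t| * (`|q| + 1) < _); first by rewrite ler_wpM2l // lerDl.
    by rewrite -ltr_pdivlMr.
  have dg t : `|t| < r1 -> is_derive (t : R) (1 : R) g (g1 t).
    move=> /inO/Oh tO; apply: is_deriveD; last exact: is_derive_quadratic.
    apply: is_derive_dotv; apply: is_derive_shift_line.
    by apply: (is_derive_C1 _ oh tO) => i y hy; exact: u1.
  have dG1 : is_derive (0 : R) (1 : R) G1 V.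
    have -> : G1 = \sum_i (fun t => q i 0 *: pd i u (t *: q + xs)).
      by apply/funext => t; rewrite fct_sumE.
    have hz i : is_derive (0 : R) (1 : R) (fun t : R => pd i u (t *: q + xs))
        (\sum_j q j 0 *: pd j (pd i u) xs).
      apply: is_derive_shift_line; rewrite scale0r add0r.
      by apply: (is_derive_C1 _ oh (Oh _ Oxs)) => j y hy; exact: u2.
    exact: is_derive_sum.
  have dg1 : is_derive (0 : R) (1 : R) g1 (dotv V mu + 2 * (- M * v2)).
    apply: is_deriveD; first exact: is_derive_dotv.
    have := is_derive_quadratic (- M * v1) (2 * (- M * v2)) 0 0.
    rewrite mulr0 addr0.
    by have -> : (fun s => - M * v1 + 2 * (- M * v2) * s + 0 * (s * s)) =
      (fun s => - M * v1 + 2 * (- M * v2) * s) by apply/funext => s; rewrite mul0r addr0.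
  have r10 : 0 < r1 by rewrite divr_gt0.
  have gm t : `|t| < r1 -> g t <= g 0.
    move=> tr; rewrite !gE scale0r add0r; exact/xs_max/inO.
  have := second_derivative_at_max r10 dg dg1 gm; lra.
have : \sum_l (dotv (\sum_i Q i l *: \sum_j Q j l *: pd j (pd i u) xs) mu -
    M * (2 * ((\sum_i Q i l * Q i l - k * (Q N l * Q N l)) / r ^+ 2))) <= 0.
  apply: sumr_le0 => l _; have := line (col l Q); rewrite /dotv !mxE expr2.
  have -> : \sum_i col l Q i 0 * col l Q i 0 = \sum_i Q i l * Q i l.
    by apply: eq_bigr => i _; rewrite !mxE.
  have -> : \sum_i col l Q i 0 *: \sum_j col l Q j 0 *: pd j (pd i u) xs =
      \sum_i Q i l *: \sum_j Q j l *: pd j (pd i u) xs.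
    apply: eq_bigr => i _; rewrite mxE; congr (_ *: _).
    by apply: eq_bigr => j _; rewrite mxE.
  by [].
have BQ i j : B i j = \sum_l Q i l * Q j l.
  by rewrite hQ mxE; apply: eq_bigr => l _; rewrite mxE.
rewrite sumrB.
(* Since [B = Q Q^T], the second derivatives of [u] along the columns of [Q] add up to the left side
   of the equation. *)
have -> : \sum_l dotv (\sum_i Q i l *: \sum_j Q j l *: pd j (pd i u) xs) mu = 0.
  have dsum (F : 'I_n.+1 -> 'cV[R]_m) : dotv (\sum_l F l) mu = \sum_l dotv (F l) mu.
    by elim: (index_enum _) => [|l s IH]; rewrite ?big_nil ?dotv0l // !big_cons dotvDl IH.
  rewrite -dsum -[RHS](dotv0l mu) -[X in _ = dotv X _](u_pde (Oh _ Oxs)); congr dotv.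
  rewrite exchange_big [RHS]exchange_big; apply: eq_bigr => i _ /=.
  under eq_bigr do rewrite scaler_sumr.
  rewrite exchange_big; apply: eq_bigr => j _ /=.
  by rewrite BQ scaler_suml; apply: eq_bigr => l _; rewrite scalerA mulrC.
rewrite sub0r -mulr_sumr -mulr_sumr -mulr_suml sumrB -mulr_sumr -BQ.
have -> : \sum_l \sum_i Q i l * Q i l = \tr B.
  by rewrite exchange_big; apply: eq_bigr => i _; rewrite BQ.
rewrite hk mulN1r !mulrN opprK leNgt => /negP; apply.
by rewrite !mulr_gt0 // invr_gt0 exprn_gt0.
Qed.

End MaximumPrinciple.

(** * Sufficiency *)

Section PhragmenLindelof.
Variables (R : realType) (n m : nat).
Variables (B : 'M[R]_n.+1).
Hypothesis B_sym : B^T = B.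
Hypothesis B_pos : forall x : 'cV[R]_n.+1, x != 0 -> 0 < dotv (B *m x) x.
Variable u : 'cV[R]_n.+1 -> 'cV[R]_m.
Hypothesis u_C2 : C2_on (half_space R n) u.
Hypothesis u_cont : {within closure (half_space R n), continuous u}.
Hypothesis u_bnd : [bounded u x | x in closure (half_space R n)].
Hypothesis u_pde : forall x, half_space R n x ->
  \sum_j \sum_k B j k *: pd j (pd k u) x = 0.
Variables q0 mu : 'cV[R]_m.
Hypothesis u_boundary : forall x : 'cV[R]_n.+1, x ord_max 0 = 0 -> dotv (u x - q0) mu <= 0.

(** If [w x0 > 0], then for large [r] the maximum of [w - M barrier] on the half-cube [|x| <= r],
    [x_n >= 0] is positive. It is not on [x_n = 0], where [w <= 0], nor on [|x| = r], where the
    barrier is at least 1 and [w <= M], nor in the interior. *)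
Lemma half_space_max_principle x0 : half_space R n x0 -> dotv (u x0 - q0) mu <= 0.
Proof.
move=> x0_pos; set N : 'I_n.+1 := ord_max in x0_pos *.
pose w x := dotv (u x - q0) mu.
have [M M0 hM] : exists2 M, 0 < M & forall x : 'cV[R]_n.+1, 0 <= x N 0 -> w x <= M.
  have [M1 [_ hM1]] := u_bnd; pose M2 := `|M1| + 1.
  have M12 : M1 < M2 by apply: le_lt_trans (ler_norm _) _; rewrite ltrDl.
  exists (m%:R * (M2 + `|q0|) * `|mu| + 1).
    by rewrite ltr_wpDl // !mulr_ge0 // !addr_ge0.
  move=> x /closure_half_space xc; have ux : `|u x| <= M2 := hM1 _ M12 _ xc.
  rewrite /w; apply: le_trans (ler_norm _) _; apply: le_trans (dotv_le _ _) _.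
  apply: le_trans (_ : m%:R * (M2 + `|q0|) * `|mu| <= _); last by rewrite lerDl.
  rewrite ler_wpM2r // ler_wpM2l //; apply: le_trans (ler_normB _ _) _.
  by rewrite lerD2r.
have bN : 0 < B N N.
  have eN : (delta_mx N 0 : 'cV[R]_n.+1) != 0.
    by apply/eqP => /matrixP/(_ N 0); rewrite !mxE !eqxx => /eqP; rewrite oner_eq0.
  have := B_pos eN; rewrite /dotv (bigD1 N) //= big1 => [|i iN]; last first.
    by rewrite [X in _ * X]mxE (negbTE iN) mulr0.
  by rewrite -colE !mxE !eqxx mulr1 addr0.
have tr0 : 0 <= \tr B.
  apply: sumr_ge0 => i _; have ei : (delta_mx i 0 : 'cV[R]_n.+1) != 0.
    by apply/eqP => /matrixP/(_ i 0); rewrite !mxE !eqxx => /eqP; rewrite oner_eq0.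
  have := B_pos ei; rewrite /dotv (bigD1 i) //= big1 => [|j ji]; last first.
    by rewrite [X in _ * X]mxE (negbTE ji) mulr0.
  by rewrite -colE !mxE !eqxx mulr1 addr0 => /ltW.
(* Chosen so that the operator takes the barrier to [- 2 / r^2]. *)
pose k := (\tr B + 1) / B N N.
have k0 : 0 <= k by rewrite divr_ge0 ?addr_ge0 // ltW.
have hk : \tr B - k * B N N = -1 by rewrite /k divfK ?gt_eqF //; ring.
rewrite leNgt; apply/negP => w0; rewrite -/(w x0) in w0.
pose c := dotv x0 x0 + k * x0 N 0.
have c0 : 0 <= c by rewrite addr_ge0 ?dotv_ge0 // mulr_ge0 // ltW.
(* The summands make [r >= 1], which bounds the barrier at [x0] by [c / r], place [x0] inside the
   half-cube, and give [M c / r < w x0]. *)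
pose r := 1 + `|x0| + M * c / w x0.
have Mc0 : 0 <= M * c / w x0 by rewrite divr_ge0 ?mulr_ge0 // ltW.
have nx0 : 0 <= `|x0| by [].
have r1 : 1 <= r by rewrite /r; lra.
have r0 : 0 < r by lra.
pose f x := w x - M * barrier k r x.
have fx0 : 0 < f x0.
  rewrite subr_gt0 /barrier -/N.
  have d0 := dotv_ge0 x0.
  have rr : (r ^+ 2)^-1 <= r^-1.
    by rewrite lef_pV2 ?posrE ?exprn_gt0 // expr2 ler_peMr // ltW.
  have i2 : 0 <= (r ^+ 2)^-1 by rewrite invr_ge0 exprn_ge0 // ltW.
  apply: le_lt_trans (_ : M * (c / r) < _).
    rewrite ler_wpM2l ?(ltW M0) // /c mulrDl lerD //; first by rewrite ler_wpM2l.
    by rewrite -mulrA ler_wpM2l // gerBl mulr_ge0 // sqr_ge0.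
  rewrite mulrA ltr_pdivrMr // -ltr_pdivrMl // (mulrC _^-1) /r; lra.
pose K := [set x : 'cV[R]_n.+1 | `|x| <= r] `&` closure (half_space R n).
have cK : compact K.
  apply: (@bounded_closed_compact_cV R _ K r) => [x [] //|].
  apply: closedI; last exact: closed_closure.
  apply: (@preimage_closed _ _ (fun x : 'cV[R]_n.+1 => `|x|) [set y | y <= r]).
    by move=> x _; exact: norm_continuous.
  exact: closed_le.
have Kx0 : K x0.
  split; first by rewrite /= /r; lra.
  by apply/closure_half_space; exact: ltW.
have cf : {within K, continuous f}.
  have cu : {within K, continuous u} by apply: continuous_subspaceW u_cont => x [].
  have cw : {within K, continuous w}.
    apply: (@within_continuous_comp _ _ _ K u (fun z => dotv (z - q0) mu)) cu.
    move=> z _; have -> : (fun z => dotv (z - q0) mu) = (fun z => dotv z mu - dotv q0 mu).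
      by apply/funext => z'; rewrite dotvBl.
    apply: (@cvgB _ _ _ (nbhs z) _ (fun z => dotv z mu) (fun=> dotv q0 mu)).
      exact: dotv_continuous.
    exact: cvg_cst.
  pose v (x : 'cV[R]_n.+1) :=
    M / r ^+ 2 * dotv x x + (M * k / r * x N 0 - M * k / r ^+ 2 * (x N 0 * x N 0)).
  have -> : f = (fun x => w x - v x).
    by apply/funext => x; rewrite /f /v /barrier -/N; ring.
  have cb : continuous v.
    have cc : continuous (fun x : 'cV[R]_n.+1 => x N 0) by exact: coord_continuous.
    have cd : continuous (fun x : 'cV[R]_n.+1 => dotv x x).
      have -> : (fun x : 'cV[R]_n.+1 => dotv x x) = (fun x => dotv (x - 0) (x - 0)).
        by apply/funext => x; rewrite subr0.
      exact: dotvv_continuous.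
    move=> x; apply: (@cvgD _ _ _ (nbhs x) _ (fun x => M / r ^+ 2 * dotv x x)
      (fun x : 'cV[R]_n.+1 => M * k / r * x N 0 - M * k / r ^+ 2 * (x N 0 * x N 0))).
      exact: (@cvgMr _ _ (nbhs x) _ (fun x => dotv x x) _ _ (cd x)).
    apply: (@cvgB _ _ _ (nbhs x) _ (fun x : 'cV[R]_n.+1 => M * k / r * x N 0)
      (fun x : 'cV[R]_n.+1 => M * k / r ^+ 2 * (x N 0 * x N 0))).
      exact: (@cvgMr _ _ (nbhs x) _ (fun x : 'cV[R]_n.+1 => x N 0) _ _ (cc x)).
    apply: (@cvgMr _ _ (nbhs x) _ (fun x : 'cV[R]_n.+1 => x N 0 * x N 0)).
    exact: (@cvgM _ _ (nbhs x) _ _ _ _ _ (cc x) (cc x)).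
  move=> x; apply: cvgB; first exact: cw.
  exact: continuous_subspaceT.
have [xs /set_mem[xsr /closure_half_space xsN] xs_max] :=
  @compact_EVT_max _ R f K (ex_intro _ x0 Kx0) cK cf.
have fxs : 0 < f xs by apply: lt_le_trans fx0 (xs_max _ (mem_set Kx0)).
have d0 := dotv_ge0 xs.
have rr0 : 0 < r ^+ 2 by rewrite exprn_gt0.
have [xs0|xsn0] := eqVneq (xs N 0) 0.
  have := u_boundary xs0; rewrite -/(w xs) => wle.
  have : 0 <= M * barrier k r xs.
    rewrite /barrier -/N xs0 mul0r expr0n mul0r subr0 mulr0 addr0.
    by rewrite mulr_ge0 ?divr_ge0 // ltW.
  by rewrite leNgt; apply/negP; rewrite -leNgt; move: fxs; rewrite /f; lra.
have xsp : 0 < xs N 0 by rewrite lt_neqAle eq_sym xsn0.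
have [xslt|xsge] := ltP (`|xs|) r.
  pose O := [set x : 'cV[R]_n.+1 | `|x| < r] `&` half_space R n.
  apply: (@no_interior_max R n m B B_sym B_pos u u_C2 u_pde q0 mu M k r O xs) => //.
  - apply: openI; last exact: open_half_space.
    apply: (@open_comp _ _ (fun x : 'cV[R]_n.+1 => `|x|) [set y | y < r]).
      by move=> x _; exact: norm_continuous.
    exact: open_lt.
  - by move=> x [].
  - move=> y [/= yr /ltW yN]; apply: xs_max; apply: mem_set; split; first exact: ltW.
    exact/closure_half_space.
have : 1 <= barrier k r xs.
  have dr : r ^+ 2 <= dotv xs xs.
    have nxs : `|xs| = r by apply/eqP; rewrite eq_le xsr xsge.
    (* The maximum norm is attained at a coordinate, and the square of that coordinate is at most
       [dotv xs xs]. *)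
    have [i hi] : exists i, r <= `|xs i 0|.
      apply: contrapT => ni.
      have : `|xs| < r.
        rewrite [ltLHS]/Num.norm /= mx_normrE; apply/bigmax_ltP; split => // -[i j] _ /=.
        by rewrite (ord1 j) ltNge; apply/negP => h; apply: ni; exists i.
      by rewrite nxs ltxx.
    apply: le_trans (sqr_coord_le_dotv xs i); rewrite -[leRHS]real_normK ?num_real //.
    by rewrite ler_pXn2r ?nnegrE // ltW.
  have t1 : xs N 0 / r <= 1.
    rewrite ler_pdivrMr // mul1r; apply: le_trans (ler_norm _) _.
    exact: le_trans (coord_le_norm _ _) xsr.
  have t0 : 0 <= xs N 0 / r by rewrite divr_ge0 // ltW.
  rewrite /barrier -/N -expr_div_n; set t := xs N 0 / r in t0 t1 *.
  apply: le_trans (_ : dotv xs xs / r ^+ 2 <= _); first by rewrite ler_pdivlMr // mul1r.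
  by rewrite lerDl mulr_ge0 // subr_ge0 expr2 ler_piMr.
have := hM xs xsN; move: fxs; rewrite /f => h1 h2 h3.
have : M * 1 <= M * barrier k r xs by rewrite ler_wpM2l ?(ltW M0).
lra.
Qed.

End PhragmenLindelof.

Section Sufficiency.
Variables (R : realType) (n m : nat).
Variable A : 'I_n.+1 -> 'I_n.+1 -> 'M[R]_m.+1.
Hypothesis A_elliptic : strongly_elliptic A.
Variable S : set 'cV[R]_m.+1.
Hypothesis S_body : convex_body S.

(** With [q] the projection of [u x0] onto the body, the maximum principle in the direction
    [u x0 - q], evaluated at [x0], gives [|u x0 - q|^2 <= 0]. *)
Lemma scalar_form_invariant (b : 'I_n.+1 -> 'I_n.+1 -> R) (A0 : 'M[R]_m.+1) :
  (forall j k, b j k = b k j) -> A0 \in unitmx ->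
  (forall j k, A j k = b j k *: A0) -> invariant_set A (half_space R n) S.
Proof.
move=> b_sym A0u AE u u_C2 u_cont u_bnd u_pde ub x0 x0_pos.
have [d dp hd] := A_elliptic.
pose e : 'cV[R]_m.+1 := const_mx 1.
(* The form [b] may be negative definite; ellipticity tested on [e] shows that [c b] is positive
   definite. *)
pose c := dotv (A0 *m e) e.
pose B : 'M[R]_n.+1 := \matrix_(j, k) (c * b j k).
have B_sym : B^T = B by apply/matrixP => j k; rewrite !mxE b_sym.
have B_pos (x : 'cV[R]_n.+1) : x != 0 -> 0 < dotv (B *m x) x.
  move=> x_neq0; have := hd x e.
  rewrite /elength !sqr_sqrtr ?dotv_ge0 //.
  have -> : dotv ((\sum_j \sum_k (x j 0 * x k 0) *: A j k) *m e) e = dotv (B *m x) x.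
    have -> : \sum_j \sum_k (x j 0 * x k 0) *: A j k =
        (\sum_j \sum_k x j 0 * x k 0 * b j k) *: A0.
      rewrite scaler_suml; apply: eq_bigr => j _; rewrite scaler_suml.
      by apply: eq_bigr => k _; rewrite [in LHS]AE scalerA.
    rewrite -scalemxAl dotvZl -/c /dotv mulr_suml; apply: eq_bigr => j _.
    rewrite mxE !mulr_suml; apply: eq_bigr => k _; rewrite mxE; ring.
  apply: lt_le_trans; rewrite !mulr_gt0 //.
    by rewrite lt_neqAle dotv_ge0 andbT eq_sym; apply: contra x_neq0 => /eqP/dotv_eq0 ->.
  apply: lt_le_trans (sqr_coord_le_dotv e 0); by rewrite mxE expr1n.
have B_pde x : half_space R n x -> \sum_j \sum_k B j k *: pd j (pd k u) x = 0.
  move=> /u_pde h; have : A0 *m (\sum_j \sum_k b j k *: pd j (pd k u) x) = 0.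
    rewrite -[RHS]h mulmx_sumr; apply: eq_bigr => j _.
    rewrite mulmx_sumr; apply: eq_bigr => k _.
    by rewrite [in RHS]AE -scalemxAr -scalemxAl.
  move/(congr1 (mulmx (invmx A0))); rewrite mulmxA mulVmx // mul1mx mulmx0 => h0.
  rewrite -[RHS](scaler0 _ c) -[in RHS]h0 scaler_sumr; apply: eq_bigr => j _.
  by rewrite scaler_sumr; apply: eq_bigr => k _; rewrite mxE scalerA.
have [q Sq hq] := convex_body_projection S_body (u x0).
have bd (x : 'cV[R]_n.+1) : x ord_max 0 = 0 -> dotv (u x - q) (u x0 - q) <= 0.
  by move=> x_b; apply: hq; apply: ub; exact/boundary_half_space.
have := half_space_max_principle B_sym B_pos u_C2 u_cont u_bnd B_pde bd x0_pos.
move=> le0; have : u x0 - q = 0.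
  by apply: dotv_eq0; apply/eqP; rewrite eq_le le0 dotv_ge0.
by move/eqP; rewrite subr_eq0 => /eqP ->.
Qed.

End Sufficiency.

(** * Recovering the coefficients from the operator *)

Section Coefficients.
Local Open Scope complex_scope.
Local Open Scope ring_scope.
Variables (R : realType) (n m : nat).
Local Notation C := R[i].
Variable A : 'I_n.+1 -> 'I_n.+1 -> 'M[R]_m.
Variables (a : 'I_n.+1 -> 'I_n.+1 -> R) (A0 : 'M[R]_m).
Hypothesis A_sym : forall j k, A j k = A k j.
Hypothesis A_op : forall u : 'cV[R]_n.+1 -> 'cV[R]_m, C2_on setT u ->
  forall x, system_op A u x = A0 *m scalar_op a u x.

(* Tested on [x |-> cos (s.x) e] at the origin. *)
Lemma operator_symbol (s : 'I_n.+1 -> R) :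
  \sum_j \sum_k (s j * s k) *: A j k = \sum_j \sum_k (s j * s k) *: (a j k *: A0).
Proof.
apply/row_matrixP => i0; apply: trmx_inj.
have key (e : 'cV[R]_m) : (\sum_j \sum_k (s j * s k) *: A j k) *m e =
    (\sum_j \sum_k (s j * s k) *: (a j k *: A0)) *m e.
  pose z k : C := (s k)%:C; pose w : 'cV[C]_m := map_mx (real_complex R) e.
  have lin0 b : lin b (0 : 'cV[R]_n.+1) = 0.
    by rewrite /lin big1 // => k _; rewrite mxE mulr0.
  have pd2 j k : pd j (pd k (expsol z w 0)) 0 = - (s j * s k) *: e.
    rewrite !pd_expsol !scaler0 !addr0 /expsol mxE !scale0r subr0 addr0.
    rewrite /ecos /esin !lin0 oppr0 expR0 cos0 sin0 mulr0 scale0r subr0 mulr1 scale1r.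
    by apply/colP => i; rewrite !mxE /=; ring.
  have := A_op (C2_on_expsol z w 0) 0.
  rewrite /system_op /scalar_op mulmx_sumr !mulmx_suml => /(congr1 -%R).
  rewrite -!sumrN => h.
  have E1 j : \sum_k (s j * s k) *: A j k *m e =
      - \sum_k A j k *m pd j (pd k (expsol z w 0)) 0.
    rewrite -sumrN; apply: eq_bigr => k _.
    by rewrite pd2 -scalemxAl -scalemxAr scaleNr opprK.
  have E2 j : (\sum_k (s j * s k) *: (a j k *: A0)) *m e =
      - (A0 *m \sum_k a j k *: pd j (pd k (expsol z w 0)) 0).
    rewrite mulmx_suml mulmx_sumr -sumrN; apply: eq_bigr => k _.
    by rewrite pd2 scaleNr scalerN mulmxN opprK -!scalemxAl -!scalemxAr !scalerA mulrC.
  rewrite (eq_bigr _ (fun j _ => mulmx_suml _ _ _ _)) (eq_bigr _ (fun j _ => E1 j)) h.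
  by rewrite (eq_bigr _ (fun j _ => E2 j)).
apply/colP => k; have /colP/(_ i0) := key (delta_mx k 0).
by rewrite -!colE !mxE.
Qed.

(** Polarization of the symbol identity. Since [a] need not be symmetric and the symbol sees only
    its symmetric part, the symmetrized coefficients appear. *)
Lemma operator_coefficients j k : A j k = ((a j k + a k j) / 2) *: A0.
Proof.
have diag p : A p p = a p p *: A0.
  by have := operator_symbol (fun q => (q == p)%:R); rewrite !sum_delta2.
have h : A j k + A j k = (a j k + a k j) *: A0.
  have := operator_symbol (fun q => (q == j)%:R + (q == k)%:R).
  rewrite !sum_delta2D !diag (A_sym k j) => h; apply/matrixP => p q.
  by move/matrixP/(_ p q): h; rewrite !mxE; lra.
by apply/matrixP => p q; move/matrixP/(_ p q): h; rewrite !mxE; lra.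
Qed.

End Coefficients.

Theorem theorem4 (R : realType) (n m : nat)
    (Ajk : 'I_n.+1 -> 'I_n.+1 -> 'M[R]_m)
    (Ajk_sym : forall j k, Ajk j k = Ajk k j)
    (Ajk_elliptic : strongly_elliptic Ajk)
    (S : set 'cV[R]_m)
    (S_body : convex_body S)
    (S_normals : exists nu : 'I_m.+1 -> 'cV[R]_m,
        (forall i, unit_normals S (nu i)) /\
        (forall I : {set 'I_m.+1}, #|I| = m -> free [seq nu i | i in I])) :
  invariant_set Ajk (half_space R n) S <->
  exists (a : 'I_n.+1 -> 'I_n.+1 -> R) (A : 'M[R]_m),
    [/\ scalar_elliptic a,
        A \in unitmx,
        strongly_elliptic (fun j k => a j k *: A)
      & forall u : 'cV[R]_n.+1 -> 'cV[R]_m, C2_on setT u ->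
          forall x, system_op Ajk u x = A *m scalar_op a u x].
Proof.
case: m Ajk Ajk_sym Ajk_elliptic S S_body S_normals => [|m] A A_sym A_ell S S_body.
  (* In dimension 0 a nonempty set is the whole space, so there is no convex body. *)
  case: S_body => D [_ [x Dx] _ DT _]; case: DT; apply/seteqP; split=> // y _.
  by have -> : y = x by rewrite [y]flatmx0 [x]flatmx0.
move=> [nu [nuS nu_free]]; split=> [S_inv|[a [A0 [_ A0u _ A_op]]]].
  exact (necessity A_sym A_ell S_body S_inv nuS nu_free).
have b_sym j k : (a j k + a k j) / 2 = (a k j + a j k) / 2 by rewrite addrC.
exact (scalar_form_invariant A_ell S_body b_sym A0u (operator_coefficients A_sym A_op)).
Qed.
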